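(* Let $X$ be a separable infinite-dimensional complex Banach space which is of uniform multiplicity infinity, with system of matrix units $\{u_{j,k}\}_{j,k=0}^{\infty}$ in $\mathcal{B}(X)$, and suppose that $\operatorname{Ran} u_{0,0}$ is infinite-dimensional and has an unconditional basis. If $\sigma\subset[0,1]$ is right closed and $1\in\sigma$, then there exists a quasinilpotent operator $T\in\mathcal{B}(X)$ such that $\Lambda(T)=\sigma$.
   Context: $\mathcal{B}(X)$ is the set of bounded linear operators on $X$. An infinite-dimensional Banach space $X$ is of uniform multiplicity infinity if there exists a system of matrix units in $\mathcal{B}(X)$, i.e. a family $\{u_{j,k}\}_{j,k=0}^{\infty}\subset\mathcal{B}(X)$ such that (a) $\sup\{\|u_{j,k}\|:j,k\ge 0\}<\infty$; (b) $u_{j,k}u_{l,m}=\delta_{kl}u_{j,m}$ for all $j,k,l,m$ (Kronecker delta); (c) $x=\sum_{k=0}^{\infty}u_{k,k}x$ for every $x\in X$, with convergence in norm. $\operatorname{Ran}$ denotes the range. A (Schauder) basis $\{x_n\}_{n=0}^\infty$ of a Banach space is unconditional if every convergent series of the form $\sum_n a_nx_n$ converges unconditionally. A set $\sigma\subset[0,1]$ is right closed if $\sup E\in\sigma$ for every nonempty subset $E$ of $\sigma$. $T\in\mathcal{B}(X)$ is quasinilpotent if its spectrum is $\{0\}$. For such $T$ and $x\in X\setminus\{0\}$, put $k_T(x)=\limsup_{\lambda\to 0}\frac{\ln\|(\lambda-T)^{-1}x\|}{\ln\|(\lambda-T)^{-1}\|}$ ($\lambda\in\mathbb{C}\setminus\{0\}$),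 and $\Lambda(T)=\{k_T(x):x\neq 0\}$ (the power set of $T$). *)

(* Defs.v *)
From HB Require Import structures.
From mathcomp Require Import all_boot all_order all_algebra.
From mathcomp Require Import all_classical all_reals all_analysis.
From mathcomp Require Import complex.

Set Implicit Arguments.
Unset Strict Implicit.
Unset Printing Implicit Defensive.

Import Order.TTheory GRing.Theory Num.Theory.
Import numFieldNormedType.Exports.

Local Open Scope classical_set_scope.
Local Open Scope ring_scope.
Local Open Scope complex_scope.

(* A complex Banach space is a [completeNormedModType R[i]]. Its norm takes
   values in [R[i]] (nonnegative reals seen as complex numbers); [rnorm] is the
   same norm with values in [R]. *)
Definition rnorm (R : realType) (X : normedModType R[i]) (x : X) : R :=
  complex.Re `|x|.

(* Only meaningful for maps that are bounded on the unit ball: [sup] is 0 on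
   unbounded sets. *)
Definition opnorm (R : realType) (X : normedModType R[i]) (f : X -> X) : R :=
  sup [set rnorm (f x) | x in [set x | rnorm x <= 1]].

Definition bounded_op (R : realType) (X : normedModType R[i])
    (T : {linear X -> X}) : Prop :=
  bounded_near T (nbhs (0 : X)).

Definition separable (T : topologicalType) : Prop :=
  exists2 D : set T, countable D & dense D.

(* [Y] is meant to be a linear subspace. *)
Definition finite_dimensional (R : realType) (X : normedModType R[i])
    (Y : set X) : Prop :=
  exists (n : nat) (v : 'I_n -> X),
    (forall i, Y (v i)) /\
    (forall y, Y y -> exists a : 'I_n -> R[i], y = \sum_(i < n) a i *: v i).

Definition infinite_dimensional (R : realType) (X : normedModType R[i])
    (Y : set X) : Prop :=
  ~ finite_dimensional Y.

Definition matrix_units (R : realType) (X : normedModType R[i])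
    (u : nat -> nat -> {linear X -> X}) : Prop :=
  [/\ forall j k, bounded_op (u j k),
      exists M : R, forall j k, opnorm (u j k) <= M,
      forall j k l m x, u j k (u l m x) = u j m x *+ (k == l)
    & forall x, series (fun k => u k k x) @ \oo --> x].

Definition uniform_multiplicity_infinity (R : realType)
    (X : completeNormedModType R[i]) : Prop :=
  infinite_dimensional [set: X] /\
  exists u : nat -> nat -> {linear X -> X}, matrix_units u.

(* [Y] is meant to be a closed linear subspace, that is, a Banach space for
   the norm of [X]. *)
Definition schauder_basis (R : realType) (X : normedModType R[i])
    (Y : set X) (b : nat -> X) : Prop :=
  (forall n, Y (b n)) /\
  (forall y, Y y ->
     exists! a : nat -> R[i], series (fun n => a n *: b n) @ \oo --> y).

Definition unconditionally_cvg (R : realType) (X : normedModType R[i])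
    (v : nat -> X) : Prop :=
  forall p : nat -> nat, bijective p -> cvgn (series (fun n => v (p n))).

Definition unconditional_basis (R : realType) (X : normedModType R[i])
    (Y : set X) (b : nat -> X) : Prop :=
  schauder_basis Y b /\
  (forall a : nat -> R[i], cvgn (series (fun n => a n *: b n)) ->
     unconditionally_cvg (fun n => a n *: b n)).

Definition right_closed (R : realType) (s : set R) : Prop :=
  forall E : set R, E `<=` s -> E !=set0 -> s (sup E).

Definition spectrum (R : realType) (X : normedModType R[i])
    (T : {linear X -> X}) : set R[i] :=
  [set l | ~ exists S : {linear X -> X},
     [/\ bounded_op S,
         forall x, S (l *: x - T x) = x
       & forall x, l *: S x - T (S x) = x]].

Definition quasinilpotent (R : realType) (X : normedModType R[i])
    (T : {linear X -> X}) : Prop :=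
  spectrum T = [set 0].

(* The value at [x] of (l - T)^-1; the [y] below is unique when [l] is outside
   the spectrum of [T]. *)
Definition resolvent (R : realType) (X : normedModType R[i])
    (T : {linear X -> X}) (l : R[i]) (x : X) : X :=
  xget 0 [set y | l *: y - T y = x].

(* The regular module [R[i]^o] carries the usual topology of the complex
   plane. *)
Definition power_index (R : realType) (X : normedModType R[i])
    (T : {linear X -> X}) (x : X) : \bar R :=
  limf_esup
    (fun l : R[i]^o =>
       (ln (rnorm (resolvent T l x)) / ln (opnorm (resolvent T l)))%:E)
    (0 : R[i]^o)^'.

Definition power_set (R : realType) (X : normedModType R[i])
    (T : {linear X -> X}) : set (\bar R) :=
  [set power_index T x | x in [set x | x != 0]].

(* Main.v *)
Require Import Defs.
From HB Require Import structures.
From mathcomp Require Import all_boot all_order all_algebra.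
From mathcomp Require Import all_classical all_reals all_analysis.
From mathcomp Require Import complex.
From mathcomp Require Import zify ring lra.

Set Implicit Arguments.
Unset Strict Implicit.
Unset Printing Implicit Defensive.

Import Order.TTheory GRing.Theory Num.Theory.
Import numFieldNormedType.Exports.

Local Open Scope classical_set_scope.
Local Open Scope ring_scope.
Local Open Scope complex_scope.

(** Put [s = - ln |l|], so that [s] tends to infinity as [l] tends to 0. For
    [0 < t <= 1] the weighted shift with weights [exp (- (2 k + 1) / t)] has
    products of [m] weights equal to [exp (- m ^ 2 / t)]; maximizing
    [m s - m ^ 2 / t] over [m], its resolvent at [l] has norm
    [exp (t s ^ 2 / 4 + O(s))], and so has the image under the resolvent of any
    nonzero vector. The shift with zero weights plays this role for [t = 0].
    Hence in a direct sum of such shifts, with parameters [tau n] in [sigma]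
    one of which is 1, a vector supported by a single summand [n] has power index
    [tau n], and a general vector has as power index the supremum of the [tau n]
    over the summands that it meets. This supremum lies in [sigma] because
    [sigma] is right closed. Conversely [sigma] contains a sequence [tau] that
    approaches each of its points from the left ([left_dense_sequence]), so each
    [t] in [sigma] is the index of a vector that meets exactly the summands with
    [tau n <= t].

    To carry a direct sum of shifts, the space only needs a total biorthogonal
    system [e k n], [phi k n] with bounds independent of [k]; the vectors
    [e k n = u k 0 (b n)], up to scaling, and the coefficients of [u 0 k x] in the
    basis [b] provide one ([biorthogonal_exists]). Continuity of the basis
    coefficients is Banach's theorem, deduced here from Zabreiko's lemma
    ([zabreiko]). The [n]-th shift is multiplied by a small factor [damp n]:
    this makes the direct sum an absolutely convergent series of rank one
    operators, and changes the logarithm of the resolvent only by [O(s)].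

    The upper estimates of the resolvent come from the Neumann series and from a
    bound of the powers of [T] on vectors meeting only summands with
    [tau n <= t] ([shift_operator_exists], [decay_gauss], [resolvent_spec]). The
    lower estimates come from the recursion satisfied by the coordinates of
    [(l - T)^-1 x] ([orbit_growth], [growth_ge_resolvent]). They hold for all
    small [l], so the upper limit defining the power index is a limit
    ([limf_esup_ratio]). *)

Notation cabs := Normc.normc.

(** * Norms with real values *)

Section RealNorm.
Variables (R : realType) (X : normedModType R[i]).
Implicit Types (x y : X) (a : R[i]).

Lemma cabsE a : `|a| = (cabs a)%:C.
Proof. by []. Qed.

Lemma cabs_ge0 a : 0 <= cabs a.
Proof. by rewrite -lecR -cabsE normr_ge0. Qed.

Lemma cabs_gt0 a : (0 < cabs a) = (a != 0).
Proof. by rewrite -ltcR -cabsE normr_gt0. Qed.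

Lemma cabs_real (r : R) : cabs r%:C = `|r|.
Proof. by rewrite /cabs /= expr0n /= addr0 sqrtr_sqr. Qed.

Lemma rnormE x : `|x| = (rnorm x)%:C.
Proof. by rewrite /rnorm RRe_real// ger0_real. Qed.

Lemma rnorm_ge0 x : 0 <= rnorm x.
Proof. by rewrite -lecR -rnormE normr_ge0. Qed.

Lemma rnorm0 : rnorm (0 : X) = 0.
Proof. by rewrite /rnorm normr0. Qed.

Lemma rnorm_eq0 x : (rnorm x == 0) = (x == 0).
Proof. by rewrite -[RHS]normr_eq0 rnormE eq_complex /= eqxx andbT. Qed.

Lemma rnorm_gt0 x : (0 < rnorm x) = (x != 0).
Proof. by rewrite lt0r rnorm_eq0 rnorm_ge0 andbT. Qed.

Lemma rnormN x : rnorm (- x) = rnorm x.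
Proof. by rewrite /rnorm normrN. Qed.

Lemma rnormB x y : rnorm (x - y) = rnorm (y - x).
Proof. by rewrite -rnormN opprB. Qed.

Lemma ler_rnormD x y : rnorm (x + y) <= rnorm x + rnorm y.
Proof. by rewrite -lecR rmorphD /= -!rnormE ler_normD. Qed.

Lemma rnormZ a x : rnorm (a *: x) = cabs a * rnorm x.
Proof. by apply: complexI; rewrite rmorphM /= -rnormE -cabsE -rnormE normrZ. Qed.

Lemma ler_rnorm_sum (I : Type) (r : seq I) (P : pred I) (F : I -> X) :
  rnorm (\sum_(i <- r | P i) F i) <= \sum_(i <- r | P i) rnorm (F i).
Proof.
elim/big_ind2 : _ => //; first by rewrite rnorm0.
by move=> x a y b xa yb; rewrite (le_trans (ler_rnormD _ _))// lerD.
Qed.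

Lemma le_rnormB x y : rnorm x - rnorm y <= rnorm (x - y).
Proof. by rewrite lerBlDr -{1}(subrK y x) ler_rnormD. Qed.

Lemma cvg_rnormP (v : nat -> X) x : v @ \oo --> x <->
  forall eps : R, 0 < eps ->
    exists N, forall n, (N <= n)%N -> rnorm (x - v n) < eps.
Proof.
split=> [/cvgrPdist_lt vx eps eps0|vx].
  have [|N _ NP] := vx eps%:C; first by rewrite ltcR.
  by exists N => n Nn; rewrite -ltcR -rnormE; apply: NP.
apply/cvgrPdist_lt => eps eps0.
have epsE : eps = (complex.Re eps)%:C by rewrite RRe_real// gtr0_real.
have [|N NP] := vx (complex.Re eps); first by rewrite -ltcR -epsE.
by exists N => // n /= Nn; rewrite rnormE epsE ltcR NP.
Qed.

Lemma cvg_rnorm_unique (v : nat -> X) x y :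
  v @ \oo --> x -> v @ \oo --> y -> x = y.
Proof. by apply: cvg_unique; exact: norm_hausdorff. Qed.

Lemma cvg_rnorm_le (v : nat -> X) x (B : R) :
  v @ \oo --> x -> (forall n, rnorm (v n) <= B) -> rnorm x <= B.
Proof.
move=> /cvg_rnormP vx vB; apply/ler_addgt0Pr => eps /vx[N /(_ N (leqnn _)) NP].
have := le_lt_trans (le_rnormB x (v N)) NP.
by have := vB N; lra.
Qed.

Lemma bounded_opP (T : {linear X -> X}) :
  bounded_op T <-> exists C : R, forall x, rnorm (T x) <= C * rnorm x.
Proof.
split=> [/linear_boundedP[M [Mr MP]]|[C TC]].
  exists (complex.Re (M + 1)) => x.
  have M1r : M + 1 \is Num.real by rewrite realD.
  rewrite -lecR rmorphM /= -!rnormE RRe_real//.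
  by apply: MP; rewrite ltrDl.
apply/linear_boundedP; exists C%:C; split.
  by apply/complex_realP; exists C.
move=> M CM x; rewrite (le_trans _ (ler_wpM2r _ (ltW CM)))//.
by rewrite !rnormE -rmorphM lecR.
Qed.

Lemma opnorm_bound (f : X -> X) (C : R) :
  0 <= C -> (forall x, rnorm (f x) <= C * rnorm x) -> opnorm f <= C.
Proof.
move=> C0 fC; apply: ge_sup.
  by exists (rnorm (f 0)), 0 => //=; rewrite rnorm0 ler01.
move=> _ [x /= x1 <-]; rewrite (le_trans (fC x))//.
by rewrite -[leRHS]mulr1 ler_wpM2l.
Qed.

Lemma rnorm_opnorm (f : {linear X -> X}) (C : R) x :
  (forall x, rnorm (f x) <= C * rnorm x) -> rnorm (f x) <= opnorm f * rnorm x.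
Proof.
move=> fC; have [->|x0] := eqVneq x 0.
  by rewrite raddf0 !rnorm0 mulr0.
rewrite -ler_pdivrMr ?rnorm_gt0//.
have xC0 : 0 <= (rnorm x)^-1 by rewrite invr_ge0 rnorm_ge0.
have -> : rnorm (f x) / rnorm x = rnorm (f ((rnorm x)^-1%:C *: x)).
  by rewrite linearZ /= rnormZ cabs_real ger0_norm// mulrC.
apply: ub_le_sup; last first.
  exists ((rnorm x)^-1%:C *: x) => //=.
  by rewrite rnormZ cabs_real ger0_norm// mulVf ?rnorm_eq0.
exists (Num.max C 0) => _ [y /= y1 <-]; rewrite (le_trans (fC y))//.
rewrite (@le_trans _ _ (Num.max C 0 * rnorm y))//.
  by rewrite ler_wpM2r ?rnorm_ge0// le_max lexx.
by rewrite -[leRHS]mulr1 ler_wpM2l// le_max lexx orbT.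
Qed.

End RealNorm.

Section Limits.
Variables (R : realType) (X Y : normedModType R[i]).

Lemma cvg_bounded_linear (f : {linear X -> Y}) (C : R) (v : nat -> X) x :
  (forall x, rnorm (f x) <= C * rnorm x) -> v @ \oo --> x ->
  (fun n => f (v n)) @ \oo --> f x.
Proof.
move=> fC /cvg_rnormP vx; apply/cvg_rnormP => eps eps0.
have C0 : 0 < Num.max C 1 by rewrite lt_max ltr01 orbT.
have [|N NP] := vx (eps / Num.max C 1); first exact: divr_gt0.
exists N => n /NP; rewrite ltr_pdivlMr// => vn.
rewrite -linearB (le_lt_trans (fC _))// (le_lt_trans _ vn)// mulrC.
by rewrite ler_wpM2l ?rnorm_ge0// le_max lexx.
Qed.

(** This computes the coordinates of a vector defined by a series: by
    biorthogonality, a coordinate functional kills almost all terms. *)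
Lemma bounded_linear_series_fin (f : {linear X -> Y}) (C : R) (v : nat -> X) x N :
  (forall x, rnorm (f x) <= C * rnorm x) -> series v @ \oo --> x ->
  (forall n, (N <= n)%N -> f (v n) = 0) -> f x = \sum_(0 <= n < N) f (v n).
Proof.
move=> fC vx fv0; apply: cvg_rnorm_unique (cvg_bounded_linear fC vx) _.
apply/cvg_rnormP => eps eps0; exists N => n Nn.
suff -> : f (series v n) = \sum_(0 <= i < N) f (v i) by rewrite subrr rnorm0.
rewrite /series /= linear_sum (@big_cat_nat _ _ _ N)//=.
rewrite [X in _ + X]big_nat_cond [X in _ + X]big1 ?addr0//.
by move=> i; rewrite andbT => /andP[/fv0].
Qed.

(** Operators defined by series are obtained as linear maps from this. *)
Lemma limit_linear (F : nat -> X -> Y) :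
  (forall N a x y, F N (a *: x + y) = a *: F N x + F N y) ->
  (forall x, exists y : Y, (fun N => F N x) @ \oo --> y) ->
  exists T : {linear X -> Y}, forall x, (fun N => F N x) @ \oo --> T x.
Proof.
move=> Flin /choice[f fP].
have f_linear : linear f.
  move=> a x y; apply: cvg_rnorm_unique (fP _) _.
  under eq_fun do rewrite Flin.
  by apply: cvgD; [apply: cvgZl_tmp; exact: fP|exact: fP].
pose L : {linear X -> Y} := HB.pack f (GRing.isLinear.Build _ _ _ _ f f_linear).
by exists L.
Qed.

End Limits.

Section GeometricSeries.
Variables (R : realType).

Lemma sum_half_lt2 m n :
  (m <= n)%N -> \sum_(m <= i < n) 2 ^- i = 2 * 2 ^- m - 2 * 2 ^- n :> R.
Proof.
move=> /subnK <-; elim: (n - m)%N => [|k IH]; first by rewrite big_geq ?subrr.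
rewrite addSn big_nat_recr ?leq_addl//= IH exprS invfM.
by rewrite (mulrA 2) mulfV ?pnatr_eq0//; ring.
Qed.

Lemma half_small (A eps : R) : 0 < eps -> exists N, A * 2 ^- N < eps.
Proof.
move=> eps0; exists (Num.truncn (`|A| / eps)).
rewrite ltr_pdivrMr ?exprn_gt0// (le_lt_trans (ler_norm _))//.
rewrite mulrC -ltr_pdivrMr// (lt_le_trans (truncnS_gt _))//.
by rewrite -natrX ler_nat ltn_expl.
Qed.

Variable X : completeNormedModType R[i].

(** The convergence criterion of all series of vectors below: the weights are
    always arranged to leave a spare factor [2 ^- n]. *)
Lemma geometric_series_cvg (v : nat -> X) (A : R) :
  (forall n, rnorm (v n) <= A * 2 ^- n) -> exists x : X, series v @ \oo --> x.
Proof.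
move=> vA.
have A0 : 0 <= A by have := le_trans (rnorm_ge0 _) (vA 0%N); rewrite expr0 invr1 mulr1.
suff : cvgn (series v) by move=> /cvg_ex[x vx]; exists x.
apply/cauchy_cvgP/cauchy_seriesP => eps eps0.
have epsE : eps = (complex.Re eps)%:C by rewrite RRe_real// gtr0_real.
have [|N NP] := @half_small (2 * A) (complex.Re eps); first by rewrite -ltcR -epsE.
exists ([set n | (N <= n)%N], [set n | (N <= n)%N]).
  by split; exists N.
move=> [m n] /= [Nm Nn]; rewrite rnormE epsE ltcR (le_lt_trans _ NP)//.
have [mn|/ltnW nm] := leqP m n; last first.
  by rewrite big_geq// rnorm0 mulr_ge0 ?mulr_ge0// invr_ge0 exprn_ge0.
rewrite (le_trans (ler_rnorm_sum _ _ _))//.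
rewrite (@le_trans _ _ (\sum_(m <= i < n) A * 2 ^- i))//.
  by apply: ler_sum.
rewrite -mulr_sumr sum_half_lt2// (mulrC 2 A) -mulrA ler_wpM2l//.
rewrite lerBlDr (@le_trans _ _ (2 * 2 ^- N))//.
  by rewrite ler_pM2l// lef_pV2 ?posrE ?exprn_gt0// ler_weXn2l// ler1n.
by rewrite lerDl mulr_ge0// invr_ge0 exprn_ge0.
Qed.

Lemma geometric_series_le (v : nat -> X) (A : R) x :
  (forall n, rnorm (v n) <= A * 2 ^- n) -> series v @ \oo --> x ->
  rnorm x <= 2 * A.
Proof.
move=> vA vx; apply: cvg_rnorm_le vx _ => n.
have A0 : 0 <= A by have := le_trans (rnorm_ge0 _) (vA 0%N); rewrite expr0 invr1 mulr1.
rewrite (le_trans (ler_rnorm_sum _ _ _))//.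
rewrite (@le_trans _ _ (\sum_(0 <= i < n) A * 2 ^- i))//.
  by apply: ler_sum.
rewrite -mulr_sumr sum_half_lt2// (mulrC 2 A) ler_wpM2l// expr0 invr1 mulr1.
by rewrite gerBl mulr_ge0// invr_ge0 exprn_ge0.
Qed.

End GeometricSeries.

(** * Zabreiko's lemma *)

Section Tails.
Variables (R : realType) (X : normedModType R[i]).

Lemma geometric_series_tail (v : nat -> X) (A : R) x n :
  (forall n, rnorm (v n) <= A * 2 ^- n) -> series v @ \oo --> x ->
  rnorm (x - series v n) <= 2 * A * 2 ^- n.
Proof.
move=> vA /cvg_rnormP vx; apply/ler_addgt0Pr => eps /vx[N NP].
have A0 : 0 <= A by have := le_trans (rnorm_ge0 _) (vA 0%N); rewrite expr0 invr1 mulr1.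
have -> : x - series v n =
    (x - series v (N + n)%N) + (series v (N + n)%N - series v n).
  by rewrite addrA subrK.
rewrite (le_trans (ler_rnormD _ _))// addrC lerD//; last first.
  by rewrite ltW// NP// leq_addr.
rewrite sub_series_geq ?leq_addl// (le_trans (ler_rnorm_sum _ _ _))//.
rewrite (@le_trans _ _ (\sum_(n <= i < N + n) A * 2 ^- i))//.
  by apply: ler_sum.
rewrite -mulr_sumr sum_half_lt2 ?leq_addl// (mulrC 2 A) -mulrA ler_wpM2l//.
by rewrite gerBl mulr_ge0// invr_ge0 exprn_ge0.
Qed.

(** Tannery's theorem, applied below to the errors of the basis expansions of
    the terms of a series: the head of the series tends to 0 term by term, and
    the domination makes the tail uniformly small. *)
Lemma tannery (g : nat -> nat -> X) (y : nat -> X) (A : R) :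
  (forall N i, rnorm (g N i) <= A * 2 ^- i) ->
  (forall i, (fun N => g N i) @ \oo --> (0 : X)) ->
  (forall N, series (g N) @ \oo --> y N) -> y @ \oo --> (0 : X).
Proof.
move=> gA g0 gy; apply/cvg_rnormP => eps eps0.
have eps20 : 0 < eps / 2 by rewrite divr_gt0.
have [I IP] := half_small (2 * A) eps20.
have : (fun N => series (g N) I) @ \oo --> (0 : X).
  elim: I {IP} => [|I IH].
    rewrite [X in X @ _ --> _](_ : _ = fun=> 0); first exact: cvg_cst.
    by apply/funext => N; rewrite /series /= big_geq.
  rewrite [X in X @ _ --> _](_ : _ = (fun N => series (g N) I) \+ g^~ I).
    by rewrite -(addr0 0); exact: cvgD.
  by apply/funext => N; rewrite /series /= big_nat_recr.
move=> /cvg_rnormP/(_ _ eps20)[N NP]; exists N => n /NP.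
rewrite sub0r rnormN => gn; rewrite sub0r rnormN -(subrK (series (g n) I) (y n)).
rewrite (le_lt_trans (ler_rnormD _ _))// [ltRHS]splitr ltrD//.
by rewrite (le_lt_trans _ IP)// geometric_series_tail.
Qed.

End Tails.

Section Zabreiko.
Variables (R : realType) (X : completeNormedModType R[i]) (p : X -> R).
Hypothesis pD : forall x y, p (x + y) <= p x + p y.
Hypothesis pZ : forall a x, p (a *: x) = cabs a * p x.
Hypothesis p_series : forall (v : nat -> X) x A,
  (forall n, p (v n) <= A * 2 ^- n) -> series v @ \oo --> x -> p x <= 2 * A.

(** Baire's argument: if no sublevel set of [p] were dense in a ball, nested
    balls avoiding the successive sublevel sets would shrink to a point at
    which [p] is infinite. *)
Lemma sublevel_dense_in_ball : exists (M : nat) (x0 : X) (r : R), 0 < r /\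
  forall y, rnorm (y - x0) < r ->
  forall eps : R, 0 < eps -> exists a, p a <= M%:R /\ rnorm (y - a) < eps.
Proof.
apply: contrapT => nP.
have step (t : nat * X * R) : exists t' : X * R, 0 < t.2 ->
    [/\ 0 < t'.2, t'.2 <= t.2 / 2, rnorm (t'.1 - t.1.2) + t'.2 <= t.2 &
        forall a, rnorm (t'.1 - a) <= t'.2 -> t.1.1%:R < p a].
  case: t => [[M x] r] /=; have [r0|r0] := ltP 0 r; last by exists (x, r).
  apply: contrapT => nt; apply: nP; exists M, x, r; split => // y yxr eps eps0.
  apply: contrapT => na; apply: nt.
  (* the closed ball of radius [s] around [y] stays in the old ball, and its
     points are within [eps] of [y], where [p] exceeds [M] *)
  pose s := Num.min (Num.min (eps / 2) (r / 2)) (r - rnorm (y - x)).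
  have s0 : 0 < s by rewrite !lt_min !divr_gt0//= subr_gt0.
  exists (y, s) => _ /=; split => //.
  - by rewrite !ge_min lexx orbT.
  - by rewrite addrC -lerBrDr !ge_min lexx !orbT.
  - move=> a ya; rewrite ltNge; apply/negP => pa; apply: na; exists a; split => //.
    rewrite (le_lt_trans ya)// (@le_lt_trans _ _ (eps / 2))//.
      by rewrite !ge_min lexx.
    by rewrite ltr_pdivrMr// ltr_pMr// ltr1n.
have [f fP] := choice step.
pose ball_ := fix F n : X * R := if n is m.+1 then f (m, (F m).1, (F m).2) else (0, 1).
have ball0 n : 0 < (ball_ n).2.
  by elim: n => [|n IH]; [exact: ltr01 | case: (fP (n, (ball_ n).1, (ball_ n).2) IH)].
have ballS n := fP (n, (ball_ n).1, (ball_ n).2) (ball0 n).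
have r_half n : (ball_ n).2 <= 1 * 2 ^- n.
  elim: n => [|n IH]; first by rewrite expr0 invr1 mulr1.
  have [_ + _ _] := ballS n; rewrite -/(ball_ n.+1) => /le_trans; apply.
  by rewrite exprSr invfM mulrA ler_wpM2r ?invr_ge0.
pose v n := (ball_ n.+1).1 - (ball_ n).1.
have vr n : rnorm (v n) <= (ball_ n).2.
  have [h0 _ + _] := ballS n; rewrite -/(ball_ n.+1) /v => h.
  by rewrite (le_trans _ h)// lerDl ltW.
have [x vx] := @geometric_series_cvg _ _ v 1 (fun n => le_trans (vr n) (r_half n)).
have vE n : series v n = (ball_ n).1.
  by rewrite /series /= telescope_sumr//= subr0.
have nested n k : rnorm ((ball_ n).1 - (ball_ (n + k)%N).1) + (ball_ (n + k)%N).2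
    <= (ball_ n).2.
  elim: k => [|k IH]; first by rewrite addn0 subrr rnorm0 add0r.
  have [_ _ + _] := ballS (n + k)%N; rewrite -/(ball_ (n + k).+1) addnS => h.
  rewrite -(subrK (ball_ (n + k)%N).1 (ball_ n).1) -addrA.
  rewrite (le_trans _ IH)// (le_trans (lerD (ler_rnormD _ _) (lexx _)))//.
  by rewrite -addrA lerD2l (le_trans _ h)// lerD2r rnormB.
have xball n : rnorm ((ball_ n).1 - x) <= (ball_ n).2.
  apply/ler_addgt0Pr => eps eps0.
  have /cvg_rnormP/(_ _ eps0)[N NP] := vx.
  rewrite -(subrK (ball_ (n + N)%N).1 (ball_ n).1) -addrA.
  rewrite (le_trans (ler_rnormD _ _))// lerD//.
    by rewrite (le_trans _ (nested n N))// lerDl ltW.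
  by rewrite rnormB -vE ltW// NP// leq_addl.
have px n : n%:R < p x.
  by have [_ _ _] := ballS n; apply; rewrite -/(ball_ n.+1) xball.
by have := px (Num.truncn (p x)).+1; rewrite ltNge (ltW (truncnS_gt _)).
Qed.

(** Near the origin a vector is approximated by one on which [p] is at most [M];
    the error is approximated in the same way at half the scale, and so on.
    Countable subadditivity sums the resulting bounds [M * 2 ^- n]. *)
Lemma zabreiko : exists C : R, 0 <= C /\ forall x, p x <= C * rnorm x.
Proof.
have [M [x0 [r [r0 dense_x0]]]] := sublevel_dense_in_ball.
(* half-differences move the ball to the origin *)
have dense0 h : rnorm h < r -> forall eps : R, 0 < eps ->
    exists a, p a <= M%:R /\ rnorm (h - a) < eps.
  move=> hr eps eps0.
  have [|a [pa ha]] := dense_x0 (x0 + h) _ _ eps0; first by rewrite addrAC subrr add0r.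
  have [|b [pb hb]] := dense_x0 (x0 - h) _ _ eps0.
    by rewrite addrAC subrr add0r rnormN.
  have half : cabs (2^-1 : R[i]) = 2^-1.
    have -> : (2^-1 : R[i]) = (2^-1)%:C by rewrite rmorphV ?unitfE//= rmorph_nat.
    by rewrite cabs_real ger0_norm ?invr_ge0.
  have halfN : cabs (- (1 : R[i])) = 1.
    by rewrite -[1]/(1%:C) -rmorphN cabs_real normrN normr1.
  exists (2^-1 *: (a - b)); split.
    rewrite pZ half -scaleN1r (le_trans (ler_wpM2l _ (pD _ _))) ?invr_ge0//.
    by rewrite pZ halfN; lra.
  have -> : h - 2^-1 *: (a - b) = 2^-1 *: ((x0 + h - a) - (x0 - h - b)).
    have {1}-> : h = 2^-1 *: (h + h).
      by rewrite -mulr2n -(scaler_nat 2 h) scalerA mulVf ?scale1r// pnatr_eq0.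
    rewrite -scalerBr; congr (_ *: _).
    rewrite !opprB !addrA [RHS](ACl ((1*6)*(2*5)*4*3))%AC /=.
    by rewrite subrr add0r.
  rewrite rnormZ half (le_lt_trans (ler_wpM2l _ (ler_rnormD _ _))) ?invr_ge0//.
  by rewrite rnormN; lra.
have two0 n : 0 < 2 ^+ n :> R by rewrite exprn_gt0.
have cabs2 n : cabs (2 ^+ n)%:C = 2 ^+ n :> R by rewrite cabs_real ger0_norm// ltW.
have cabs2V n : cabs (2 ^- n)%:C = 2 ^- n :> R.
  by rewrite cabs_real ger0_norm// invr_ge0 ltW.
(* the approximation at scale [2 ^- n], by homogeneity *)
have step (t : nat * X) : exists a, rnorm t.2 < r * 2 ^- t.1 ->
    p a <= M%:R * 2 ^- t.1 /\ rnorm (t.2 - a) < r * 2 ^- t.1.+1.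
  case: t => n h /=; have [hr|_] := ltP (rnorm h) (r * 2 ^- n); last by exists 0.
  have [||a [pa ha]] := dense0 ((2 ^+ n)%:C *: h) _ (r / 2).
  - by rewrite rnormZ cabs2 mulrC -ltr_pdivlMr.
  - by rewrite divr_gt0.
  exists ((2 ^- n)%:C *: a) => _; split.
    by rewrite pZ cabs2V mulrC ler_wpM2r// invr_ge0 ltW.
  have -> : h - (2 ^- n)%:C *: a = (2 ^- n)%:C *: ((2 ^+ n)%:C *: h - a).
    by rewrite scalerBr scalerA -rmorphM mulVf ?gt_eqF// scale1r.
  rewrite rnormZ cabs2V exprS invfM mulrA mulrC.
  by rewrite ltr_pM2r// invr_gt0.
have [f fP] := choice step.
have small h : rnorm h < r -> p h <= 2 * M%:R.
  move=> hr.
  pose rest := fix F n : X := if n is m.+1 then F m - f (m, F m) else h.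
  have restr n : rnorm (rest n) < r * 2 ^- n.
    elim: n => [|n IH]; first by rewrite expr0 invr1 mulr1.
    by have [] := fP (n, rest n) IH.
  apply: (p_series (v := fun n => f (n, rest n))).
    by move=> n; have [] := fP (n, rest n) (restr n).
  have sE n : series (fun n => f (n, rest n)) n = h - rest n.
    elim: n => [|n IH]; first by rewrite /series /= big_geq// subrr.
    by rewrite seriesS IH /= opprB addrCA.
  apply/cvg_rnormP => eps eps0.
  have [N NP] := half_small r eps0.
  exists N => n Nn; rewrite sE opprB addrC subrK (lt_trans (restr n))//.
  rewrite (le_lt_trans _ NP)// ler_pM2l//.
  by rewrite lef_pV2 ?posrE ?exprn_gt0// ler_weXn2l// ler1n.
exists (4 * M%:R / r); split; first by rewrite divr_ge0 ?mulr_ge0// ltW.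
move=> x; have [->|x0'] := eqVneq x 0.
  by rewrite -(scale0r 0) pZ Normc.normc0 mul0r rnormZ Normc.normc0 mul0r mulr0.
have nx0 : 0 < rnorm x by rewrite rnorm_gt0.
have c0 : 0 < r / (2 * rnorm x) by rewrite divr_gt0// mulr_gt0.
have := small ((r / (2 * rnorm x))%:C *: x).
rewrite rnormZ pZ cabs_real gtr0_norm//.
have -> : r / (2 * rnorm x) * rnorm x = r / 2 by field; rewrite gt_eqF.
move=> /(_ _)/wrap[]; first by rewrite ltr_pdivrMr// ltr_pMr// ltr1n.
rewrite mulrC -ler_pdivlMr// => /le_trans; apply.
by rewrite le_eqVlt; apply/orP; left; apply/eqP; field; rewrite !gt_eqF.
Qed.

End Zabreiko.

(** * Coefficient functionals of a Schauder basis *)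

Section ComplexSeries.
Variable R : realType.

Lemma cabs_le_Re_Im (z : R[i]) :
  cabs z <= `|complex.Re z| + `|complex.Im z|.
Proof.
rewrite {1}[z]complexE (le_trans (le_normcD _ _))// Normc.normcM !cabs_real.
by rewrite lerD2l /Normc.normc /= expr0n /= add0r expr1n sqrtr1 mul1r.
Qed.

Lemma real_geometric_series_cvg (a : nat -> R) (A : R) :
  (forall n, `|a n| <= A * 2 ^- n) -> cvgn (series a).
Proof.
move=> aA; apply: (@normed_cvg _ R^o).
apply: (@series_le_cvg _ _ (geometric A 2^-1)) => [n|n|n|].
- exact: normr_ge0.
- by rewrite /= exprVn (le_trans _ (aA n)).
- by rewrite /= exprVn.
- by apply: is_cvg_geometric_series; rewrite ger0_norm ?invr_ge0// invf_lt1// ltr1n.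
Qed.

Lemma complex_geometric_series_cvg (a : nat -> R[i]) (A : R) :
  (forall n, cabs (a n) <= A * 2 ^- n) ->
  exists s : R[i]^o, series (a : nat -> R[i]^o) @ \oo --> s.
Proof.
move=> aA.
have Re_le n : `|complex.Re (a n)| <= A * 2 ^- n.
  by rewrite (le_trans _ (aA n))// -lecR -cabsE normc_ge_Re.
have Im_le n : `|complex.Im (a n)| <= A * 2 ^- n.
  rewrite (le_trans _ (aA n))// -normrN -ReiNIm -lecR (le_trans (normc_ge_Re _))//.
  rewrite cabsE lecR Normc.normcM [cabs 'i]/Normc.normc /=.
  by rewrite expr0n /= add0r expr1n sqrtr1 mulr1.
have /cvg_ex[s /cvgrPdist_lt sP] := real_geometric_series_cvg Re_le.
have /cvg_ex[t /cvgrPdist_lt tP] := real_geometric_series_cvg Im_le.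
exists (s +i* t); apply/cvg_rnormP => eps eps0.
have eps20 : 0 < eps / 2 by rewrite divr_gt0.
have [N1 _ sN] := sP _ eps20.
have [N2 _ tN] := tP _ eps20.
exists (maxn N1 N2) => n; rewrite geq_max => /andP[/sN/= sn /tN/= tn].
have -> : series (a : nat -> R[i]^o) n =
    series (fun i => complex.Re (a i)) n +i* series (fun i => complex.Im (a i)) n.
  rewrite /series /=; elim: n {sn tn} => [|n IH]; first by rewrite !big_geq.
  by rewrite !big_nat_recr//= IH; case: (a n).
rewrite (le_lt_trans (cabs_le_Re_Im _))// [ltRHS]splitr ltrD//.
Qed.

End ComplexSeries.

(** [P] projects onto the closed span of [b], and [c x] are the coefficients of
    [P x] in the basis [b]. *)
Section BasisCoefficients.
Variables (R : realType) (X : completeNormedModType R[i]).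
Variables (P : {linear X -> X}) (CP : R) (b : nat -> X) (c : X -> nat -> R[i]).
Hypothesis P_bounded : forall x, rnorm (P x) <= CP * rnorm x.
Hypothesis c_series : forall x, series (fun n => c x n *: b n) @ \oo --> P x.
Hypothesis c_unique : forall x (a : nat -> R[i]),
  series (fun n => a n *: b n) @ \oo --> P x -> a = c x.

Let partial_sum x N := series (fun n => c x n *: b n) N.

Lemma coefficient_linear n a x y : c (a *: x + y) n = a * c x n + c y n.
Proof.
suff <- : (fun n => a * c x n + c y n) = c (a *: x + y) by [].
apply: c_unique; rewrite linearP.
rewrite [X in X @ _ --> _](_ : _ = (fun N => a *: partial_sum x N) \+ partial_sum y).
  by apply: cvgD; [apply: cvgZl_tmp|]; exact: c_series.
apply/funext => N; rewrite /partial_sum /series /= scaler_sumr -big_split /=.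
by apply: eq_bigr => i _; rewrite scalerDl scalerA.
Qed.

Lemma partial_sum_linear N a x y :
  partial_sum (a *: x + y) N = a *: partial_sum x N + partial_sum y N.
Proof.
rewrite /partial_sum /series /= scaler_sumr -big_split /=.
by apply: eq_bigr => i _; rewrite coefficient_linear scalerDl scalerA.
Qed.

Lemma basis_vector_neq0 n : b n != 0.
Proof.
apply/eqP => bn0; have : (fun m => c 0 m + (m == n)%:R) = c 0.
  apply: c_unique; rewrite [X in X @ _ --> _](_ : _ = partial_sum 0).
    exact: c_series.
  apply/funext => N; apply: eq_bigr => i _.
  by have [->|_] := eqVneq i n; rewrite ?bn0 ?scaler0// addr0.
move=> /(congr1 (@^~ n))/eqP; rewrite eqxx -subr_eq0 addrAC subrr add0r.
by rewrite oner_eq0.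
Qed.

(** The seminorm for which all partial sum operators are contractions; Zabreiko's
    lemma will compare it to the given norm. *)
Let basis_norm x := sup (range (fun N => rnorm (partial_sum x N))).

Lemma basis_norm_has_sup x :
  has_sup (range (fun N => rnorm (partial_sum x N))).
Proof.
split; first by exists (rnorm (partial_sum x 0)), 0%N.
have /(cvg_rnormP _ (P x)).1/(_ _ ltr01)[N NP] :
    partial_sum x @ \oo --> P x by exact: c_series.
exists (rnorm (P x) + 1 + \sum_(0 <= n < N) rnorm (c x n *: b n)) => _ [n _ <-].
have [Nn|nN] := leqP N n.
  rewrite -[leLHS]addr0 lerD ?sumr_ge0//; last by move=> i _; exact: rnorm_ge0.
  have := le_rnormB (partial_sum x n) (P x).
  by have := NP n Nn; rewrite rnormB; lra.
rewrite -[leLHS]add0r lerD ?addr_ge0 ?rnorm_ge0//.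
rewrite (le_trans (ler_rnorm_sum _ _ _))//.
rewrite (@big_cat_nat _ _ _ n 0 N)//= ?(ltnW nN)// lerDl sumr_ge0// => i _.
exact: rnorm_ge0.
Qed.

Lemma partial_sum_le_basis_norm x N : rnorm (partial_sum x N) <= basis_norm x.
Proof. by apply: ub_le_sup; [have [] := basis_norm_has_sup x|exists N]. Qed.

Lemma basis_norm_le x (A : R) :
  (forall N, rnorm (partial_sum x N) <= A) -> basis_norm x <= A.
Proof.
by move=> xA; apply: ge_sup; [have [] := basis_norm_has_sup x|move=> _ [N _ <-]].
Qed.

Lemma basis_normD x y : basis_norm (x + y) <= basis_norm x + basis_norm y.
Proof.
apply: basis_norm_le => N; rewrite -[x]scale1r partial_sum_linear !scale1r.
by rewrite (le_trans (ler_rnormD _ _))// lerD// partial_sum_le_basis_norm.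
Qed.

Lemma basis_normZ_le a x : basis_norm (a *: x) <= cabs a * basis_norm x.
Proof.
apply: basis_norm_le => N.
have -> : partial_sum (a *: x) N = a *: partial_sum x N.
  have := partial_sum_linear N a x 0; rewrite addr0 => ->.
  have := partial_sum_linear N 1 0 0; rewrite scaler0 addr0 scale1r => /eqP.
  by rewrite -subr_eq0 opprD addNKr oppr_eq0 => /eqP ->; rewrite addr0.
by rewrite rnormZ ler_wpM2l ?cabs_ge0// partial_sum_le_basis_norm.
Qed.

Lemma basis_normZ a x : basis_norm (a *: x) = cabs a * basis_norm x.
Proof.
have basis_norm_ge0 y : 0 <= basis_norm y.
  by rewrite (le_trans _ (partial_sum_le_basis_norm y 0))// rnorm_ge0.
apply/eqP; rewrite eq_le basis_normZ_le /=.
have [->|a0] := eqVneq a 0; first by rewrite Normc.normc0 mul0r.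
rewrite -ler_pdivlMl ?cabs_gt0// -Normc.normcV.
by rewrite (le_trans _ (basis_normZ_le _ _))// scalerA mulVf// scale1r.
Qed.

(** If [x] is the sum of a series of [v i] whose basis norms are dominated by a
    geometric series, summing coefficientwise gives an expansion of [P x]; by
    uniqueness it is the basis expansion. *)
Lemma basis_norm_series (v : nat -> X) x A :
  (forall i, basis_norm (v i) <= A * 2 ^- i) -> series v @ \oo --> x ->
  basis_norm x <= 2 * A.
Proof.
move=> vA vx.
have psA N i : rnorm (partial_sum (v i) N) <= A * 2 ^- i.
  by rewrite (le_trans (partial_sum_le_basis_norm _ _)).
have coef_le i n : cabs (c (v i) n) <= 2 * A / rnorm (b n) * 2 ^- i.
  rewrite mulrAC ler_pdivlMr ?rnorm_gt0 ?basis_vector_neq0// -rnormZ.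
  have -> : c (v i) n *: b n = partial_sum (v i) n.+1 - partial_sum (v i) n.
    by rewrite /partial_sum seriesS addrK.
  rewrite (le_trans (ler_rnormD _ _))// rnormN.
  by have := psA n.+1 i; have := psA n i; lra.
have /choice[d dP] : forall n, exists s : R[i]^o,
    series (fun i => c (v i) n : R[i]^o) @ \oo --> s.
  by move=> n; exact: complex_geometric_series_cvg (coef_le^~ n).
pose z N := \sum_(0 <= n < N) d n *: b n.
have zP N : series (fun i => partial_sum (v i) N) @ \oo --> z N.
  elim: N => [|N IH].
    rewrite /z big_geq// [X in X @ _ --> _](_ : _ = fun=> 0); first exact: cvg_cst.
    apply/funext => k; rewrite /series /= big1// => i _.
    by rewrite /partial_sum /series /= big_geq.
  rewrite /z big_nat_recr//=.
  rewrite [X in X @ _ --> _](_ : _ = (fun k => series (fun i => partial_sum (v i) N) k)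
      \+ (fun k => series (fun i => c (v i) N : R[i]^o) k *: b N)).
    by apply: cvgD; [exact: IH|apply: cvgZr_tmp; exact: dP].
  apply/funext => k; rewrite /series /= scaler_suml -big_split /=.
  by apply: eq_bigr => i _; rewrite /partial_sum seriesS addrC.
have Pv_le i : rnorm (P (v i)) <= A * 2 ^- i.
  by apply: (cvg_rnorm_le (v := partial_sum (v i))) => [|N];
    [exact: c_series|exact: psA].
have Pv : series (fun i => P (v i)) @ \oo --> P x.
  have := cvg_bounded_linear P_bounded vx; rewrite /series /=.
  by under eq_fun do rewrite linear_sum.
have diff0 : (fun N => z N - P x) @ \oo --> (0 : X).
  apply: (tannery (g := fun N i => partial_sum (v i) N - P (v i)) (A := 2 * A)).
  - move=> N i; rewrite (le_trans (ler_rnormD _ _))// rnormN.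
    by have := psA N i; have := Pv_le i; lra.
  - move=> i; rewrite -(subrr (P (v i))).
    by apply: cvgB; [exact: c_series|exact: cvg_cst].
  - move=> N; rewrite [X in X @ _ --> _](_ : _ =
      (fun k => series (fun i => partial_sum (v i) N) k - series (fun i => P (v i)) k)).
      by apply: cvgB; [exact: zP|exact: Pv].
    by apply/funext => k; rewrite /series /= sumrB.
have dE : d = c x.
  apply: c_unique; rewrite -[P x]add0r.
  rewrite [X in X @ _ --> _](_ : _ = (fun N => z N - P x + P x)).
    by apply: cvgD; [exact: diff0|exact: cvg_cst].
  by apply/funext => N; rewrite subrK.
apply: basis_norm_le => N; rewrite /partial_sum -dE.
exact: geometric_series_le (psA N) (zP N).
Qed.

(** The [n]-th term of an expansion is a difference of two partial sums, hence
    controlled by the basis norm. *)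
Lemma coefficient_bounded n :
  exists C : R, forall x, cabs (c x n) <= C * rnorm x.
Proof.
have [C [C0 CP']] := zabreiko basis_normD basis_normZ basis_norm_series.
exists (2 * C / rnorm (b n)) => x.
rewrite mulrAC ler_pdivlMr ?rnorm_gt0 ?basis_vector_neq0// -rnormZ.
have -> : c x n *: b n = partial_sum x n.+1 - partial_sum x n.
  by rewrite /partial_sum seriesS addrK.
rewrite (le_trans (ler_rnormD _ _))// rnormN.
have := le_trans (partial_sum_le_basis_norm x n) (CP' x).
by have := le_trans (partial_sum_le_basis_norm x n.+1) (CP' x); lra.
Qed.

End BasisCoefficients.

(** * A total biorthogonal system *)

Section Biorthogonal.
Variables (R : realType) (X : completeNormedModType R[i]).

(** The bounds do not depend on the first index, along which the operator of
    the theorem will shift. *)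
Record biorthogonal (e : nat -> nat -> X)
    (phi : nat -> nat -> {linear X -> R[i]^o}) (C : nat -> R) : Prop := {
  bio_norm : forall k n, rnorm (e k n) <= 1;
  bio_ge1 : forall n, 1 <= C n;
  bio_bounded : forall k n x, cabs (phi k n x) <= C n * rnorm x;
  bio_dual : forall k n k' n', phi k n (e k' n') = ((k == k') && (n == n'))%:R;
  bio_total : forall x, (forall k n, phi k n x = 0) -> x = 0 }.

Variable u : nat -> nat -> {linear X -> X}.
Hypothesis u_units : matrix_units u.

Lemma matrix_units_bounded :
  exists2 M : R, 1 <= M & forall j k x, rnorm (u j k x) <= M * rnorm x.
Proof.
have [u_bounded [M uM] _ _] := u_units.
exists (Num.max M 1); first by rewrite le_max lexx orbT.
move=> j k x; have [C uC] := (bounded_opP _).1 (u_bounded j k).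
rewrite (le_trans (rnorm_opnorm x uC))// ler_wpM2r ?rnorm_ge0//.
by rewrite le_max uM.
Qed.

(** [u k 0] copies the basis [b] into the range of [u k k], and [u 0 k] brings
    vectors back for their coefficients to be read. If all coefficients of [x]
    vanish, so do all [u k k x], whose sum is [x]. *)
Lemma biorthogonal_exists (b : nat -> X) :
  schauder_basis (range (u 0%N 0%N)) b ->
  exists e phi C, biorthogonal e phi C.
Proof.
have [M M1 uM] := matrix_units_bounded.
have M0 : 0 < M := lt_le_trans ltr01 M1.
have [_ _ u_mul u_sum] := u_units.
move=> [b_range b_basis]; pose P := u 0%N 0%N.
have Pb n : P (b n) = b n.
  by have [w _ <-] := b_range n; rewrite /P u_mul eqxx mulr1n.
have /choice[c cP] : forall x, exists a : nat -> R[i],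
    series (fun n => a n *: b n) @ \oo --> P x /\
    forall a', series (fun n => a' n *: b n) @ \oo --> P x -> a' = a.
  move=> x; have [|a [aP a_uniq]] := b_basis (P x); first by exists x.
  by exists a; split => // a' /a_uniq.
have c_series x : series (fun n => c x n *: b n) @ \oo --> P x := (cP x).1.
have c_unique x := (cP x).2.
have c_bounded n := coefficient_bounded (uM 0%N 0%N) c_series c_unique n.
have c_linear n : linear ((fun x => c x n) : X -> R[i]^o).
  by move=> a x y; rewrite (coefficient_linear c_series c_unique).
have b0 n : 0 < rnorm (b n).
  by rewrite rnorm_gt0 (basis_vector_neq0 c_series c_unique).
have cb m n : c (b m) n = (n == m)%:R.
  suff <- : (fun n => (n == m)%:R) = c (b m) by [].
  apply: c_unique; rewrite Pb; apply/cvg_rnormP => eps eps0.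
  exists m.+1 => k mk; rewrite /series /=.
  rewrite (bigD1_seq m) ?mem_index_iota ?iota_uniq//= eqxx scale1r.
  rewrite big1 ?addr0 ?subrr ?rnorm0// => i /negPf ->.
  by rewrite scale0r.
have /choice[C CP] : forall n, exists C : R,
    0 <= C /\ forall x, cabs (c x n) <= C * rnorm x.
  move=> n; have [C CP] := c_bounded n.
  exists (Num.max C 0); split; first by rewrite le_max lexx orbT.
  move=> x; rewrite (le_trans (CP x))// ler_wpM2r ?rnorm_ge0//.
  by rewrite le_max lexx.
pose cL n : {linear X -> R[i]^o} :=
  HB.pack (fun x => c x n : R[i]^o) (GRing.isLinear.Build _ _ _ _ _ (c_linear n)).
pose q n : R := M * rnorm (b n).
have q0 n : 0 < q n by rewrite mulr_gt0.
pose phi k n : {linear X -> R[i]^o} := ((q n)%:C : R[i]) \*: (cL n \o u 0%N k).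
exists (fun k n => (q n)^-1%:C *: u k 0%N (b n)), phi.
exists (fun n => Num.max 1 (q n * (C n * M))); split.
- move=> k n; rewrite rnormZ cabs_real gtr0_norm ?invr_gt0// mulrC.
  by rewrite ler_pdivrMr// mul1r.
- by move=> n; rewrite le_max lexx.
- move=> k n x.
  have -> : phi k n x = (q n)%:C * c (u 0%N k x) n by [].
  rewrite Normc.normcM cabs_real gtr0_norm//.
  rewrite (@le_trans _ _ (q n * (C n * M) * rnorm x))//.
    rewrite -[leRHS]mulrA ler_pM2l// -mulrA (le_trans ((CP _).2 _))// ler_wpM2l//.
    exact: (CP n).1.
  by rewrite ler_wpM2r ?rnorm_ge0// le_max lexx orbT.
- move=> k n k' n'.
  have -> : phi k n ((q n')^-1%:C *: u k' 0%N (b n')) =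
      (q n)%:C * c (u 0%N k ((q n')^-1%:C *: u k' 0%N (b n'))) n by [].
  rewrite linearZ /= u_mul -/P Pb.
  have [_|_] := eqVneq k k'; last first.
    by rewrite mulr0n scaler0 [c 0 n](linear0 (cL n)) mulr0.
  have := coefficient_linear c_series c_unique n (q n')^-1%:C (b n') 0.
  rewrite addr0 [c 0 n](linear0 (cL n)) addr0 mulr1n cb => ->.
  have [->|_] := eqVneq n n'; last by rewrite !mulr0.
  by rewrite /= mulr1 -rmorphM mulfV ?gt_eqF.
- move=> x phi0; apply: cvg_rnorm_unique (u_sum x) _.
  suff uk0 k : u k k x = 0.
    rewrite [X in X @ _ --> _](_ : _ = fun=> 0); first exact: cvg_cst.
    by apply/funext => N; rewrite /series /= big1.
  have cu0 n : c (u 0%N k x) n = 0.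
    have /eqP : (q n)%:C * c (u 0%N k x) n = 0 := phi0 k n.
    by rewrite mulf_eq0 eq_complex /= eqxx andbT gt_eqF//= => /eqP.
  have Pux0 : P (u 0%N k x) = 0.
    apply: cvg_rnorm_unique (c_series _) _.
    rewrite [X in X @ _ --> _](_ : _ = fun=> 0); first exact: cvg_cst.
    by apply/funext => N; rewrite /series /= big1// => i _; rewrite cu0 scale0r.
  have : u k 0%N (P (u 0%N k x)) = u k k x by rewrite /P !u_mul eqxx !mulr1n.
  by rewrite Pux0 linear0.
Qed.

End Biorthogonal.

(** * A left-dense sequence in a right closed set *)

Section LeftDense.
Variable R : realType.

(** A point of [s] that is a limit of smaller points of [s] is approached by
    points chosen in intervals with rational ends; any other point is the least
    element of [s] above some rational number. Both families are countable. *)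
Lemma left_dense_sequence (s : set R) : s 1 ->
  exists tau : nat -> R, [/\ tau 0%N = 1, forall n, s (tau n) &
    forall t eps, s t -> 0 < eps -> exists n, t - eps < tau n <= t].
Proof.
move=> s1.
pose between (p : rat * rat) : set R := [set t | s t /\ ratr p.1 < t < ratr p.2].
pose least (p : rat) : set R :=
  [set t | [/\ s t, ratr p < t & forall t', s t' -> ratr p < t' -> t <= t']].
pose point (i : rat * rat + rat) : R :=
  match i with inl p => xget 1 (between p) | inr p => xget 1 (least p) end.
have s_point i : s (point i).
  by case: i => p /=; case: xgetP => // t _ [].
exists (fun n => if n is m.+1 then
  if unpickle m is Some i then point i else 1 else 1).
split => [//|[|n]//|t eps st eps0].
  by case: unpickle.
suff [i /andP[ti it]] : exists i, t - eps < point i <= t.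
  by exists (pickle i).+1; rewrite pickleK ti.
have [p /andP[tp pt]] : exists p : rat, t - eps < ratr p < t.
  have [] := @rat_in_itvoo R (t - eps) t; first by rewrite gtrBl.
  by move=> p; rewrite in_itv/=; exists p.
have [[t' [st' /andP[pt' t't]]]|no] :=
    pselect (exists t', s t' /\ ratr p < t' < t).
  have [q] := @rat_in_itvoo R t' t t't.
  rewrite in_itv/= => /andP[t'q qt].
  exists (inl (p, q)) => /=; case: xgetP => [x _ [_ /= /andP[px xq]]|].
    by rewrite (lt_trans tp px) (ltW (lt_trans xq qt)).
  by move=> /(_ t')[]; split => //=; rewrite pt' t'q.
exists (inr p) => /=; case: xgetP => [x _ [_ px x_least]|].
  by rewrite (lt_trans tp px) x_least.
move=> /(_ t)[]; split => // t'' st'' pt''; rewrite leNgt; apply/negP => t''t.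
by apply: no; exists t''; rewrite pt''.
Qed.

End LeftDense.

(** * A direct sum of weighted shifts *)

Section ShiftOperator.
Variables (R : realType) (X : completeNormedModType R[i]).
Variables (e : nat -> nat -> X) (phi : nat -> nat -> {linear X -> R[i]^o}).
Variables (C : nat -> R) (bio : biorthogonal e phi C) (beta : nat -> R).
Hypothesis beta_ge0 : forall n, 0 <= beta n.
Hypothesis beta_le : forall n, beta n <= 2^-1.

(** A damping factor that makes the sum over the second index absolutely
    convergent, whatever the bounds [C n] are. *)
Definition damp n : R := 4 ^- n / C n.

Lemma damp_gt0 n : 0 < damp n.
Proof.
by rewrite divr_gt0 ?invr_gt0 ?exprn_gt0// (lt_le_trans ltr01)// (bio_ge1 bio).
Qed.

Lemma dampC n : damp n * C n = 4 ^- n.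
Proof. by rewrite divfK// gt_eqF// (lt_le_trans ltr01)// (bio_ge1 bio). Qed.

Lemma damp_le1 n : damp n <= 1.
Proof.
rewrite ler_pdivrMr ?(lt_le_trans ltr01 (bio_ge1 bio n))// mul1r.
rewrite (le_trans _ (bio_ge1 bio n))// invf_le1 ?exprn_gt0//.
by rewrite exprn_ege1// ler1n.
Qed.

(** The weight of the [j]-th power of the shift with weights
    [damp n * beta n ^+ (2 * k + 1)]: a sum of consecutive odd numbers is a
    difference of squares. *)
Definition weight j k n : R := damp n ^+ j * beta n ^+ (j * j + 2 * k * j).

Lemma weightS j k n : weight 1 (k + j) n * weight j k n = weight j.+1 k n.
Proof.
rewrite /weight expr1 exprS mulrACA -exprD; congr (_ * _ ^+ _).
by lia.
Qed.

(** The terms with [k + n = N] are grouped, so that a single series runs over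
    all pairs [(k, n)]. *)
Definition shift_term j x N : X :=
  \sum_(k < N.+1) ((weight j k (N - k))%:C * (phi k (N - k)%N x : R[i]))
    *: e (k + j)%N (N - k)%N.

(** The factors [damp n] and [beta n ^+ (2 * k * j)] give [4 ^- N] for each of
    the [N + 1] terms, and [B ^+ (j * j)] remains. *)
Lemma shift_term_le j x (B : R) N :
  (0 < j)%N -> 0 <= B -> (forall k n, phi k n x != 0 -> beta n <= B) ->
  rnorm (shift_term j x N) <= B ^+ (j * j) * rnorm x * 2 ^- N.
Proof.
move=> j0 B0 xB; rewrite (le_trans (ler_rnorm_sum _ _ _))//.
rewrite (@le_trans _ _ (\sum_(k < N.+1) B ^+ (j * j) * rnorm x * 4 ^- N))//; last first.
  rewrite sumr_const card_ord -[_ *+ N.+1]mulr_natr -mulrA ler_wpM2l//.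
    by rewrite mulr_ge0 ?exprn_ge0// rnorm_ge0.
  have -> : (4 : R) = 2 * 2 by rewrite -natrM.
  rewrite exprMn_comm; last exact: commr_nat.
  rewrite invfM -mulrA ger_pMr ?invr_gt0 ?exprn_gt0//.
  by rewrite mulrC ler_pdivrMr ?exprn_gt0// mul1r -natrX ler_nat ltn_expl.
apply: ler_sum => -[k /= kN] _; rewrite ltnS in kN.
rewrite rnormZ Normc.normcM cabs_real.
have [->|xkn] := eqVneq (phi k (N - k)%N x : R[i]) 0.
  by rewrite Normc.normc0 mulr0 mul0r !mulr_ge0 ?exprn_ge0 ?rnorm_ge0//.
rewrite ger0_norm; last by rewrite mulr_ge0 ?exprn_ge0// ltW// damp_gt0.
set n := (N - k)%N in xkn *.
rewrite (@le_trans _ _ (weight j k n * (C n * rnorm x)))//.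
  rewrite -[leRHS]mulr1 ler_pM ?rnorm_ge0// ?(bio_norm bio)//.
    by rewrite mulr_ge0 ?cabs_ge0// mulr_ge0 ?exprn_ge0// ltW// damp_gt0.
  rewrite ler_wpM2l ?(bio_bounded bio)//.
  by rewrite mulr_ge0 ?exprn_ge0// ltW// damp_gt0.
rewrite mulrA [leRHS]mulrAC ler_wpM2r ?rnorm_ge0//.
have -> : 4 ^- N = 4 ^- n * 2^-1 ^+ (2 * k) :> R.
  have -> : N = (n + k)%N by rewrite subnK.
  rewrite exprD invfM exprM -[4 ^- k]exprVn; congr (_ * _ ^+ _).
  by rewrite exprVn -natrX.
have d0 := ltW (damp_gt0 n); have d1 := damp_le1 n; have bn0 := beta_ge0 n.
have b1 : beta n <= 1 by rewrite (le_trans (beta_le n))// invf_le1// ler1n.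
have expr_le (q : R) : 0 <= q -> q <= 1 -> q ^+ j <= q.
  by case: (j) j0 => // i _ q0 q1; rewrite exprS ler_piMr// exprn_ile1.
have dj : damp n ^+ j <= damp n by exact: expr_le.
have bB : beta n ^+ (j * j) <= B ^+ (j * j).
  by rewrite lerXn2r ?nnegrE// (xB _ _ xkn).
have bk : beta n ^+ (2 * k * j) <= 2^-1 ^+ (2 * k).
  rewrite exprM (le_trans (expr_le _ _ _)) ?exprn_ge0// ?exprn_ile1//.
  by rewrite lerXn2r ?nnegrE ?invr_ge0.
rewrite /weight exprD -dampC.
rewrite (@le_trans _ _ (damp n * (B ^+ (j * j) * 2^-1 ^+ (2 * k)) * C n))//.
  rewrite ler_wpM2r ?(le_trans ler01 (bio_ge1 bio n))//.
  by rewrite ler_pM ?mulr_ge0 ?exprn_ge0// ler_pM ?exprn_ge0.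
by rewrite le_eqVlt; apply/orP; left; apply/eqP; ring.
Qed.

Lemma shift_term_linear j N a x y :
  shift_term j (a *: x + y) N = a *: shift_term j x N + shift_term j y N.
Proof.
rewrite /shift_term scaler_sumr -big_split /=; apply: eq_bigr => k _.
rewrite linearP /= scalerA -scalerDl; congr (_ *: _).
by rewrite mulrDr mulrCA.
Qed.

Lemma phi_shift_term j x N m n : phi m n (shift_term j x N) =
  if (j <= m)%N && (N == m - j + n)%N
  then (weight j (m - j) n)%:C * (phi (m - j)%N n x : R[i]) else 0.
Proof.
rewrite /shift_term linear_sum /=.
have scaleE (a : R[i]) (z : R[i]^o) : a *: z = a * (z : R[i]) by [].
under eq_bigr => k _ do rewrite linearZ /= (bio_dual bio) scaleE.
case: ifPn => [/andP[jm /eqP NE]|jmN].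
  have kN : (m - j < N.+1)%N by rewrite NE ltnS leq_addr.
  rewrite (bigD1 (Ordinal kN))//= big1 ?addr0; last first.
    move=> [k kN'] /=; rewrite -val_eqE /= => km.
    rewrite (_ : (m == k + j)%N = false) ?mulr0//.
    by apply/negbTE; apply: contraNneq km => ->; rewrite addnK.
  have -> : (N - (m - j))%N = n by rewrite NE addKn.
  by rewrite subnK// !eqxx mulr1.
rewrite big1// => -[k kN] _ /=; rewrite ltnS in kN.
case: eqP => [mE|]; rewrite ?mulr0//; case: eqP => [nE|]; rewrite ?mulr0//.
by move: jmN; rewrite mE nE leq_addl addnK subnKC ?eqxx.
Qed.

Lemma shift_power_exists j : (0 < j)%N ->
  exists T : {linear X -> X}, forall x, series (shift_term j x) @ \oo --> T x.
Proof.
move=> j0; apply: limit_linear => [N a x y|x].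
  rewrite /series /= scaler_sumr -big_split /=.
  by apply: eq_bigr => i _; exact: shift_term_linear.
apply: (geometric_series_cvg (A := 2^-1 ^+ (j * j) * rnorm x)) => N.
by apply: shift_term_le; rewrite ?invr_ge0.
Qed.

Lemma phi_shift j (T : {linear X -> X}) x m n :
  (forall x, series (shift_term j x) @ \oo --> T x) ->
  phi m n (T x) =
  if (j <= m)%N then (weight j (m - j) n)%:C * (phi (m - j)%N n x : R[i]) else 0.
Proof.
move=> TP; rewrite (bounded_linear_series_fin (Y := R[i]^o)
  (N := (m + n).+1) (bio_bounded bio m n) (TP x)); last first.
  move=> N mnN; rewrite phi_shift_term ifF//; apply/negbTE; rewrite negb_and.
  by apply/orP; right; lia.
under eq_bigr do rewrite phi_shift_term.
case: leqP => jm /=; last by rewrite big1.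
rewrite (bigD1_seq (m - j + n)%N) ?mem_index_iota ?iota_uniq//=; last by lia.
by rewrite eqxx big1 ?addr0// => i /negPf ->.
Qed.

(** The powers of the shift are series of the same kind: by totality it is enough
    to compare coordinates. *)
Lemma shift_operator_exists : exists T : {linear X -> X}, [/\
  forall n x, phi 0%N n (T x) = 0,
  forall m n x, phi m.+1 n (T x) =
    (damp n * beta n ^+ (2 * m).+1)%:C * (phi m n x : R[i]) &
  forall x (B : R) j, 0 <= B -> (forall k n, phi k n x != 0 -> beta n <= B) ->
    rnorm (iter j T x) <= 2 * (B ^+ (j * j) * rnorm x)].
Proof.
have /choice[S SP] : forall j, exists T : {linear X -> X},
    forall x, series (shift_term j.+1 x) @ \oo --> T x.
  by move=> j; exact: shift_power_exists.
exists (S 0%N); split => [n x|m n x|x B j B0 xB].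
- by rewrite (phi_shift _ _ _ (SP 0%N)).
- rewrite (phi_shift _ _ _ (SP 0%N))/= subn1 /= /weight expr1.
  by congr ((_ * _ ^+ _)%:C * _); lia.
have iterE i : iter i.+1 (S 0%N) x = S i x.
  elim: i => [//|i IH]; rewrite iterS IH; apply/eqP; rewrite -subr_eq0; apply/eqP.
  apply: (bio_total bio) => m n; rewrite linearB /=; apply/eqP; rewrite subr_eq0.
  rewrite !(phi_shift _ _ _ (SP _)).
  case: m => [//|m] /=; rewrite subn1 /= ltnS subSS.
  case: ltnP => im; last by rewrite mulr0.
  by rewrite mulrA -rmorphM /= -{1}(subnK im) weightS.
case: j => [|j].
  by rewrite /= expr0 mul1r ler_peMl ?rnorm_ge0// ler1n.
rewrite iterE; apply: geometric_series_le (SP j x) => N.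
exact: shift_term_le.
Qed.

End ShiftOperator.

(** * The Neumann series *)

Section Neumann.
Variables (R : realType) (X : completeNormedModType R[i]).
Variables (T : {linear X -> X}) (C : R).
Hypothesis T_bounded : forall x, rnorm (T x) <= C * rnorm x.
Variables (l : R[i]) (A : R).
Hypothesis l_neq0 : l != 0.

Let term x j := l ^- j.+1 *: iter j T x.

Hypothesis term_le : forall x j, rnorm (term x j) <= A * rnorm x * 2 ^- j.

Lemma iter_linear j a x y : iter j T (a *: x + y) = a *: iter j T x + iter j T y.
Proof. by elim: j => //= j ->; rewrite linearP. Qed.

Lemma neumann_partial_linear N a x y :
  series (term (a *: x + y)) N = a *: series (term x) N + series (term y) N.
Proof.
rewrite /series /= scaler_sumr -big_split /=; apply: eq_bigr => j _.
by rewrite /term iter_linear scalerDr !scalerA mulrC.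
Qed.

(** The same telescoping sum proves that the Neumann series is a left and a
    right inverse. *)
Lemma neumann_telescope x N :
  l *: series (term x) N - T (series (term x) N) = x - l ^- N *: iter N T x.
Proof.
elim: N => [|N IH].
  by rewrite /series /= big_geq// scaler0 linear0 expr0 invr1 scale1r !subrr.
rewrite seriesS scalerDr linearD /= opprD addrACA IH /term scalerA.
have -> : T (l ^- N.+1 *: iter N T x) = l ^- N.+1 *: iter N.+1 T x by rewrite linearZ.
by rewrite exprS invfM mulrA mulfV// mul1r addrC addrA subrK.
Qed.

Lemma neumann_remainder x : (fun N => x - l ^- N *: iter N T x) @ \oo --> x.
Proof.
apply/cvg_rnormP => eps eps0.
have [N NP] := half_small (cabs l * (A * rnorm x)) eps0.
exists N => n Nn; rewrite opprB addrC subrK.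
have -> : l ^- n *: iter n T x = l *: term x n.
  by rewrite /term scalerA exprS invfM mulrA mulfV// mul1r.
have tx := term_le x 0%N; rewrite expr0 invr1 mulr1 in tx.
rewrite rnormZ (le_lt_trans _ NP)// -mulrA ler_wpM2l ?cabs_ge0//.
rewrite (le_trans (term_le _ _))// ler_wpM2l//.
  by rewrite (le_trans (rnorm_ge0 _) tx).
by rewrite lef_pV2 ?posrE ?exprn_gt0// ler_weXn2l// ler1n.
Qed.

Lemma neumann : exists S : {linear X -> X}, [/\
  forall x, S (l *: x - T x) = x,
  forall x, l *: S x - T (S x) = x &
  forall x B, (forall j, rnorm (term x j) <= B * 2 ^- j) -> rnorm (S x) <= 2 * B].
Proof.
have [S SP] : exists S : {linear X -> X},
    forall x, (fun N => series (term x) N) @ \oo --> S x.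
  apply: limit_linear => [N a x y|x]; first exact: neumann_partial_linear.
  exact: geometric_series_cvg (term_le x).
exists S; split => x.
- apply: cvg_rnorm_unique (SP _) _.
  rewrite [X in X @ _ --> _](_ : _ = (fun N => x - l ^- N *: iter N T x)).
    exact: neumann_remainder.
  apply/funext => N; rewrite -neumann_telescope addrC -scaleN1r.
  rewrite neumann_partial_linear scaleN1r addrC; congr (_ - _).
    rewrite -[l *: x]addr0 neumann_partial_linear.
    rewrite [series (term 0) N](_ : _ = 0) ?addr0//.
    by rewrite /series /= big1// => j _; rewrite /term iter_fix ?scaler0 ?linear0.
  rewrite /series /= linear_sum /=; apply: eq_bigr => j _.
  by rewrite /term linearZ /= -iterS iterSr.
- apply: (cvg_rnorm_unique (v := fun N => x - l ^- N *: iter N T x)); last first.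
    exact: neumann_remainder.
  under eq_fun do rewrite -neumann_telescope.
  apply: cvgB; first by apply: cvgZl_tmp; exact: SP.
  exact: cvg_bounded_linear T_bounded (SP x).
- by move=> B xB; apply: geometric_series_le xB (SP x).
Qed.

(** The left inverse makes the solution picked by [resolvent] the only one. *)
Lemma resolventE (S : X -> X) (S_left : forall x, S (l *: x - T x) = x)
  (S_right : forall x, l *: S x - T (S x) = x) : resolvent T l = S.
Proof.
apply/funext => x; apply: xget_unique; first exact: S_right.
by move=> y /= <-; rewrite S_left.
Qed.

End Neumann.

(** * Growth estimates *)

Section RealEstimates.
Variable R : realType.
Implicit Types (s t : R).

(** The weight parameter of the shift of index [t]: with weights
    [decay t ^+ (2 * k + 1)], the products of the first [m] weights are
    [expR (- m ^ 2 / t)], whose Legendre transform is [t * s ^ 2 / 4]. *)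
Definition decay t : R := if t == 0 then 0 else expR (- t^-1).

Lemma decay_ge0 t : 0 <= decay t.
Proof. by rewrite /decay; case: ifP => // _; exact: expR_ge0. Qed.

Lemma expRN1_le_half : expR (-1) <= 2^-1 :> R.
Proof.
by rewrite expRN lef_pV2 ?posrE ?expR_gt0//; have := expR_ge1Dx (1 : R); lra.
Qed.

Lemma decay_le t t' : 0 <= t -> t <= t' -> decay t <= decay t'.
Proof.
rewrite le_eqVlt => /predU1P[<- _|t0 tt']; first by rewrite {1}/decay eqxx decay_ge0.
have t'0 := lt_le_trans t0 tt'.
by rewrite /decay !gt_eqF// ler_expR lerN2 lef_pV2.
Qed.

Lemma decay_le_half t : 0 <= t -> t <= 1 -> decay t <= 2^-1.
Proof.
move=> t0 t1; rewrite (le_trans (decay_le t0 t1))// /decay oner_eq0 invr1.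
exact: expRN1_le_half.
Qed.

(** Completing the square in [j * (s + 1) - j ^ 2 / t]; the unit added to [s]
    pays for the factor [2 ^- j]. *)
Lemma decay_gauss t s j : 0 <= t ->
  decay t ^+ (j * j) * expR s ^+ j <= expR (t * (s + 1) ^+ 2 / 4) * 2 ^- j.
Proof.
rewrite le_eqVlt => /predU1P[<-|t0].
  rewrite /decay eqxx mul0r mul0r expR0 mul1r; case: j => [|j].
    by rewrite !expr0 mul1r invr1.
  by rewrite expr0n /= mul0r invr_ge0 exprn_ge0.
rewrite /decay gt_eqF// -!expRM_natl -expRD.
apply: (@le_trans _ _ (expR (t * (s + 1) ^+ 2 / 4) * expR (-1) ^+ j)); last first.
  rewrite ler_wpM2l ?expR_ge0// -exprVn.
  by rewrite lerXn2r ?nnegrE ?expR_ge0 ?invr_ge0// expRN1_le_half.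
rewrite -expRM_natl -expRD ler_expR natrM.
have -> : t * (s + 1) ^+ 2 / 4 + j%:R * -1 =
  j%:R * j%:R * - t^-1 + j%:R * s + (j%:R - t * (s + 1) / 2) ^+ 2 / t.
  by field; rewrite gt_eqF.
by rewrite lerDl divr_ge0 ?sqr_ge0// ltW.
Qed.

Lemma linear_le_quadratic (A eta : R) : 0 < eta ->
  exists s0, forall s, s0 <= s -> A * (s + 1) <= eta * s ^+ 2.
Proof.
move=> eta0; exists (Num.max 1 (2 * `|A| / eta)) => s.
rewrite ge_max => /andP[s1]; rewrite ler_pdivrMr// => As.
have A1 : A * (s + 1) <= `|A| * (2 * s).
  rewrite (le_trans (ler_wpM2r _ (ler_norm A)))//; first by lra.
  by rewrite ler_wpM2l//; lra.
rewrite (le_trans A1)// expr2 mulrA (mulrC eta).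
by rewrite mulrA (mulrC _ 2) ler_wpM2r//; lra.
Qed.

(** A perturbed weighted shift recursion: a step loses at most a factor 2 as
    long as [B] is below half of the incoming term. This persists up to an index
    close to [t * s / 2], where the unperturbed orbit is largest. *)
Lemma orbit_growth t (d a B : R) (k0 : nat) :
  0 <= t -> t <= 1 -> 0 < d -> d <= 1 -> 0 < a -> a <= B ->
  exists A s0 : R, forall s, s0 <= s -> forall Y : nat -> R,
    Y k0 = expR s * a ->
    (forall m, (k0 <= m)%N ->
      expR s * (d * decay t ^+ (2 * m).+1 * Y m - B) <= Y m.+1) ->
    exists m, expR (t * s ^+ 2 / 4 - A * (s + 1)) <= Y m.
Proof.
move=> t0 t1 d0 d1 a0 aB.
have B0 := lt_le_trans a0 aB.
move: t0; rewrite le_eqVlt => /predU1P[t0|t0].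
  exists `|ln a|, 0 => s s0 Y Yk0 _; exists k0.
  rewrite Yk0 -{2}(lnK a0) -expRD ler_expR -t0 mul0r mul0r.
  have := ler_norm (- ln a); rewrite normrN => lna.
  by have := mulr_ge0 (normr_ge0 (ln a)) s0; lra.
(* the incoming term is at least [2 * B] at step [n] when
   [(2 n + 1) / t <= s - c]; such a step
   multiplies by at least [expR (s - p - (2 n + 1) / t)] *)
pose c := ln (2 * B / a) - ln d.
pose p := ln 2 - ln d.
have g1 : 2 <= 2 * B / a by rewrite ler_pdivlMr// ler_pM2l.
have lnd : ln d <= 0 by rewrite ln_le0.
have c0 : 0 <= c by rewrite subr_ge0 (le_trans lnd)// ln_ge0; lra.
have p0 : 0 <= p by rewrite subr_ge0 (le_trans lnd)// ln_ge0; lra.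
have ti0 : 0 < t^-1 by rewrite invr_gt0.
exists (c + p + k0%:R + t^-1 + `|ln a|), (c + 2 * (k0%:R + 1) / t).
move=> s s0 Y Yk0 YS.
have claim m : (k0 <= m)%N -> 2 * m%:R <= t * (s - c) ->
    a * expR s <= Y m /\
    a * expR s * expR ((m%:R - k0%:R) * (s - p) - (m%:R ^+ 2 - k0%:R ^+ 2) / t) <= Y m.
  move=> /subnKC <-; elim: (m - k0)%N => [_|i IH].
    by rewrite addn0 !subrr mul0r mul0r subr0 expR0 mulr1 Yk0 mulrC lexx.
  rewrite addnS; set n := (k0 + i)%N in IH * => nS.
  have nS' : n.+1%:R = n%:R + 1 :> R by rewrite -natr1.
  have [IH1 IH2] : a * expR s <= Y n /\
      a * expR s * expR ((n%:R - k0%:R) * (s - p) - (n%:R ^+ 2 - k0%:R ^+ 2) / t) <= Y n.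
    by apply: IH; rewrite nS' in nS; lra.
  have wE : decay t ^+ (2 * n).+1 = expR (- (2 * n%:R + 1) / t).
    rewrite /decay gt_eqF// -expRM_natl; congr expR.
    by rewrite -natr1 natrM; ring.
  pose w := d * decay t ^+ (2 * n).+1.
  have w0 : 0 < w by rewrite mulr_gt0// wE expR_gt0.
  have sn : (2 * n%:R + 1) / t <= s - c.
    by rewrite ler_pdivrMr// [leRHS]mulrC; rewrite nS' in nS; lra.
  have ws : 2 * B / a <= expR s * w.
    rewrite -[leLHS]lnK ?posrE; last by lra.
    rewrite /w wE -{1}(lnK d0) -!expRD ler_expR.
    by move: sn; rewrite /c mulNr; lra.
  have wY : 2 * B <= w * Y n.
    rewrite (@le_trans _ _ (w * (a * expR s)))//; last by rewrite ler_pM2l.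
    have -> : w * (a * expR s) = expR s * w * a by ring.
    by rewrite -ler_pdivrMr.
  have stepE : expR s * w * 2^-1 = expR (s - p - (2 * n%:R + 1) / t).
    rewrite /w wE -{1}(lnK d0) -[2^-1]lnK ?posrE ?invr_gt0// lnV ?posrE//.
    by rewrite -!expRD; congr expR; rewrite /p mulNr; ring.
  have stepY : expR (s - p - (2 * n%:R + 1) / t) * Y n <= Y n.+1.
    rewrite (le_trans _ (YS n (leq_addr _ _)))// -/w -stepE//.
    have -> : expR s * w * 2^-1 * Y n = expR s * (2^-1 * (w * Y n)) by ring.
    by rewrite ler_pM2l ?expR_gt0//; lra.
  have Yn0 : 0 <= Y n by rewrite (le_trans _ IH1)// mulr_ge0 ?expR_ge0// ltW.
  split.
    rewrite (le_trans IH1)// (le_trans _ stepY)// -stepE ler_peMl//.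
    by rewrite ler_pdivlMr// mul1r (le_trans g1).
  rewrite (le_trans _ stepY)//.
  apply: le_trans (ler_wpM2l (expR_ge0 _) IH2).
  rewrite mulrCA ler_wpM2l ?mulr_ge0 ?expR_ge0 ?(ltW a0)//.
  rewrite -expRD ler_expR nS' le_eqVlt; apply/orP; left; apply/eqP.
  by ring.
(* [m s - m ^ 2 / t] is maximal at [t s / 2] *)
pose m := Num.truncn (t * (s - c) / 2).
have sc : 2 * (k0%:R + 1) <= t * (s - c).
  by move: s0; rewrite -lerBrDl ler_pdivrMr// [leRHS]mulrC.
have k00 : 0 <= k0%:R :> R by [].
have sc0 : 0 <= t * (s - c) / 2 by lra.
have /andP[mle mgt] := truncn_itv sc0; rewrite -/m in mle mgt.
rewrite -[m.+1%:R]natr1 in mgt.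
have k0m : (k0 <= m)%N.
  by rewrite -(ler_nat R) -(lerD2r 1); lra.
have [|_ Ym] := claim _ k0m; first by lra.
exists m; apply: le_trans Ym.
rewrite -{2}(lnK a0) -!expRD ler_expR.
have sc1 : 0 <= s - c by rewrite -(pmulr_rge0 _ t0); lra.
have m0 : 0 <= m%:R :> R by [].
have h1 : (t * (s - c) / 2 - m%:R) ^+ 2 / t <= t^-1.
  rewrite ler_piMl ?(ltW ti0)// expr_le1//; lra.
have h2 : t * (c * s) <= c * s by rewrite ler_piMl// mulr_ge0//; lra.
have h3 : m%:R * p <= s * p.
  rewrite ler_wpM2r// (le_trans mle)//.
  have : t * (s - c) <= 1 * (s - c) by rewrite ler_wpM2r.
  by lra.
have h4 := ler_norm (- ln a); rewrite normrN in h4.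
have h5 : 0 <= k0%:R * p by rewrite mulr_ge0.
have h6 : 0 <= k0%:R ^+ 2 / t by rewrite divr_ge0 ?exprn_ge0// ltW.
have h7 : 0 <= t * c ^+ 2 by rewrite mulr_ge0 ?sqr_ge0// ltW.
have h8 : 0 <= m%:R * c by rewrite mulr_ge0.
have h9 : 0 <= `|ln a| * s by rewrite mulr_ge0//; lra.
have h10 : 0 <= t^-1 * s by rewrite mulr_ge0 ?(ltW ti0)//; lra.
have E : (m%:R - k0%:R) * (s - p) - (m%:R ^+ 2 - k0%:R ^+ 2) / t =
  t * s ^+ 2 / 4 - t * (c * s) / 2 + t * c ^+ 2 / 4
    - (t * (s - c) / 2 - m%:R) ^+ 2 / t + m%:R * c - m%:R * p - k0%:R * s
    + k0%:R * p + k0%:R ^+ 2 / t.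
  by field; rewrite gt_eqF.
have s00 : 0 <= s by lra.
have h11 : 0 <= c * s by rewrite mulr_ge0.
rewrite E; set th := (t * (s - c) / 2 - m%:R) ^+ 2 / t in h1 *.
by clearbody th; lra.
Qed.

End RealEstimates.

(** * The power index from logarithmic growth *)

Section Growth.
Variable R : realType.
Implicit Types (f : R[i] -> R) (t : R).

(** With [s = - ln (cabs l)], these say that [ln (f l)] is at most, respectively
    at least, [(t + o(1)) * s ^ 2 / 4]. *)
Definition growth_le f t := forall eta, 0 < eta -> exists s0, forall l : R[i],
  l != 0 -> s0 <= - ln (cabs l) -> ln (f l) <= (t + eta) * (ln (cabs l) ^+ 2 / 4).

Definition growth_ge f t := forall eta, 0 < eta -> exists s0, forall l : R[i],
  l != 0 -> s0 <= - ln (cabs l) -> (t - eta) * (ln (cabs l) ^+ 2 / 4) <= ln (f l).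

Lemma growth_leW f t (A s1 : R) :
  (forall l : R[i], l != 0 -> s1 <= - ln (cabs l) ->
    ln (f l) <= t * (ln (cabs l) ^+ 2 / 4) + A * (- ln (cabs l) + 1)) ->
  growth_le f t.
Proof.
move=> fA eta eta0; have eta40 : 0 < eta / 4 by rewrite divr_gt0.
have [s0 s0P] := linear_le_quadratic A eta40.
exists (Num.max s0 s1) => l l0; rewrite ge_max => /andP[/s0P + ls1].
by have := fA l l0 ls1; rewrite sqrrN; lra.
Qed.

Lemma growth_geW f t (A s1 : R) :
  (forall l : R[i], l != 0 -> s1 <= - ln (cabs l) ->
    t * (ln (cabs l) ^+ 2 / 4) - A * (- ln (cabs l) + 1) <= ln (f l)) ->
  growth_ge f t.
Proof.
move=> fA eta eta0; have eta40 : 0 < eta / 4 by rewrite divr_gt0.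
have [s0 s0P] := linear_le_quadratic A eta40.
exists (Num.max s0 s1) => l l0; rewrite ge_max => /andP[/s0P + ls1].
by have := fA l l0 ls1; rewrite sqrrN; lra.
Qed.

Lemma near_punctured_log (s0 : R) :
  \forall l \near (0 : R[i]^o)^', (l : R[i]) != 0 /\ s0 <= - ln (cabs l).
Proof.
have e0 : (0 : R[i]) < (expR (- s0))%:C by rewrite ltcR expR_gt0.
have near_neq0 := @nbhs_dnbhs_neq R[i]^o 0.
have near_lt := @dnbhs0_lt _ R[i]^o _ e0.
apply: filterS2 near_neq0 near_lt => l l0 ls; split => //.
rewrite lerNr -[leRHS]expRK ler_ln ?posrE ?expR_gt0 ?cabs_gt0//.
by rewrite -lecR -cabsE ltW.
Qed.

(** The quotient of logarithms is squeezed between [t - eta] and [t + eta] near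
    0; as punctured neighbourhoods are nonempty, its upper limit is [t]. *)
Lemma limf_esup_ratio f g t : 0 <= t -> t <= 1 ->
  growth_le f t -> growth_ge f t -> growth_le g 1 -> growth_ge g 1 ->
  limf_esup (fun l : R[i]^o => (ln (f l) / ln (g l))%:E) (0 : R[i]^o)^' = t%:E.
Proof.
move=> t0 t1 fle fge gle gge.
have ratio eta : 0 < eta -> \forall l \near (0 : R[i]^o)^',
    t - eta <= ln (f l) / ln (g l) <= t + eta.
  (* this [d] satisfies [t + d <= (t + eta) * (1 - d)] and
     [(t - eta) * (1 + d) <= t - d] for [t <= 1] *)
  move=> eta0; pose d := eta / (2 + eta).
  have d0 : 0 < d by rewrite divr_gt0//; lra.
  have dE : d * (2 + eta) = eta by rewrite /d divfK// gt_eqF//; lra.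
  have d1 : d < 1 by rewrite ltr_pdivrMr; lra.
  have td : t * d <= d by rewrite ler_piMl// ltW.
  have td0 : 0 <= t * d by rewrite mulr_ge0// ltW.
  have de0 : 0 <= d * eta by rewrite mulr_ge0// ltW.
  have [s1 s1P] := fle _ d0; have [s2 s2P] := fge _ d0.
  have [s3 s3P] := gle _ d0; have [s4 s4P] := gge _ d0.
  have := near_punctured_log (Num.max 1 (Num.max (Num.max s1 s2) (Num.max s3 s4))).
  apply: filterS => l [l0]; rewrite !ge_max => /and3P[ls].
  move=> /andP[/(s1P _ l0) + /(s2P _ l0)+] /andP[/(s3P _ l0)+ /(s4P _ l0)].
  have : 0 < ln (cabs l) ^+ 2 / 4.
    by rewrite divr_gt0// -sqrrN exprn_gt0// (lt_le_trans ltr01).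
  set q := ln (cabs l) ^+ 2 / 4; set N := ln (f l); set D := ln (g l).
  move=> q0 Nle Nge Dle Dge.
  have q'0 : 0 < (1 - d) * q by rewrite mulr_gt0// subr_gt0.
  have D0 : 0 < D by rewrite (lt_le_trans q'0).
  rewrite ler_pdivlMr// ler_pdivrMr//; apply/andP; split.
    have [te|te] := leP 0 (t - eta).
      rewrite (le_trans (ler_wpM2l te Dle))// (le_trans _ Nge)// mulrA ler_pM2r//.
      by lra.
    rewrite (le_trans (ler_wnM2l (ltW te) Dge))// (le_trans _ Nge)// mulrA ler_pM2r//.
    by lra.
  rewrite (le_trans Nle)//.
  apply: le_trans (ler_wpM2l _ Dge); last by lra.
  by rewrite [leRHS]mulrA ler_pM2r//; lra.
apply/eqP; rewrite eq_le; apply/andP; split; rewrite limf_esupE.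
  apply/lee_addgt0Pr => eta /ratio near_eta; apply: ge_ereal_inf.
  exists (ereal_sup [set (ln (f l) / ln (g l))%:E |
    l in [set l : R[i]^o | t - eta <= ln (f l) / ln (g l) <= t + eta]]).
    by exists [set l : R[i]^o | t - eta <= ln (f l) / ln (g l) <= t + eta].
  apply: ge_ereal_sup => _ [l /= /andP[_ le_l] <-].
  by rewrite -EFinD lee_fin.
apply: le_ereal_inf_tmp => _ [V V0 <-]; apply/lee_addgt0Pr => eta /ratio near_eta.
have [l [Vl /= /andP[le_l _]]] := filter_ex (filterI V0 near_eta).
rewrite -leeBlDr// -EFinB; apply: (le_trans (y := (ln (f l) / ln (g l))%:E)).
  by rewrite lee_fin.
by apply: ereal_sup_ubound; exists l.
Qed.

End Growth.

(** * The power set of the direct sum of shifts *)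

Section PowerSet.
Variables (R : realType) (X : completeNormedModType R[i]).
Variables (e : nat -> nat -> X) (phi : nat -> nat -> {linear X -> R[i]^o}).
Variables (C : nat -> R) (bio : biorthogonal e phi C) (tau : nat -> R).
Hypothesis tau0 : tau 0%N = 1.
Hypothesis tau_ge0 : forall n, 0 <= tau n.
Hypothesis tau_le1 : forall n, tau n <= 1.
Variable T : {linear X -> X}.
Hypothesis phi0T : forall n x, phi 0%N n (T x) = 0.
Hypothesis phiST : forall m n x, phi m.+1 n (T x) =
  (damp C n * decay (tau n) ^+ (2 * m).+1)%:C * (phi m n x : R[i]).
Hypothesis T_iter : forall x (B : R) j, 0 <= B ->
  (forall k n, phi k n x != 0 -> decay (tau n) <= B) ->
  rnorm (iter j T x) <= 2 * (B ^+ (j * j) * rnorm x).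

Lemma shift_bounded x : rnorm (T x) <= 1 * rnorm x.
Proof.
have half0 : 0 <= 2^-1 :> R by rewrite invr_ge0.
rewrite mul1r (le_trans (T_iter (x := x) 1 half0 _))//.
  by move=> k n _; exact: decay_le_half.
by rewrite muln1 expr1 mulrA mulfV// mul1r.
Qed.

Lemma neumann_term_le (l : R[i]) x t j : l != 0 -> 0 <= t ->
  (forall k n, phi k n x != 0 -> tau n <= t) ->
  rnorm (l ^- j.+1 *: iter j T x) <=
    2 * expR (- ln (cabs l)) * expR (t * (- ln (cabs l) + 1) ^+ 2 / 4)
      * rnorm x * 2 ^- j.
Proof.
move=> l0 t0 xt; set s := - ln (cabs l).
have lE : cabs (l ^- j.+1) = expR s * expR s ^+ j.
  have cabsX (z : R[i]) n : cabs (z ^+ n) = cabs z ^+ n.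
    by elim: n => [|n IH]; rewrite ?Normc.normc1// !exprS Normc.normcM IH.
  by rewrite -exprVn cabsX Normc.normcV -exprS /s expRN lnK ?posrE ?cabs_gt0.
rewrite rnormZ lE.
have /(T_iter j (decay_ge0 t)) iter_le : forall k n, phi k n x != 0 ->
    decay (tau n) <= decay t.
  by move=> k n /xt; exact: decay_le.
rewrite (le_trans (ler_wpM2l _ iter_le)) ?mulr_ge0 ?exprn_ge0 ?expR_ge0//.
have -> : expR s * expR s ^+ j * (2 * (decay t ^+ (j * j) * rnorm x)) =
  2 * expR s * rnorm x * (decay t ^+ (j * j) * expR s ^+ j) by ring.
rewrite (le_trans (ler_wpM2l _ (decay_gauss s j t0))) ?mulr_ge0 ?expR_ge0 ?rnorm_ge0//.
by rewrite le_eqVlt; apply/orP; left; apply/eqP; ring.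
Qed.

(** All that the sequel uses of the resolvent. Its bound improves on vectors
    that meet only summands of small parameter. *)
Lemma resolvent_spec (l : R[i]) : l != 0 -> exists S : {linear X -> X}, [/\
  resolvent T l = S,
  forall x, S (l *: x - T x) = x,
  forall x, l *: S x - T (S x) = x &
  forall x t, 0 <= t -> (forall k n, phi k n x != 0 -> tau n <= t) ->
    rnorm (S x) <= 4 * expR (- ln (cabs l))
      * expR (t * (- ln (cabs l) + 1) ^+ 2 / 4) * rnorm x].
Proof.
move=> l0.
have [|S [SL SR S_le]] := neumann (C := 1) shift_bounded
  (A := 2 * expR (- ln (cabs l)) * expR (1 * (- ln (cabs l) + 1) ^+ 2 / 4)) l0.
  by move=> x j; apply: neumann_term_le.
exists S; split => //; first exact: resolventE.
move=> x t t0 xt; rewrite (le_trans (S_le _ _ (fun j => neumann_term_le j l0 t0 xt)))//.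
by rewrite le_eqVlt; apply/orP; left; apply/eqP; ring.
Qed.

Lemma resolvent_neq0 (l : R[i]) x : l != 0 -> x != 0 -> 0 < rnorm (resolvent T l x).
Proof.
move=> l0 x0; have [S [-> _ SR _]] := resolvent_spec l0.
rewrite rnorm_gt0; apply: contra_neq x0 => Sx0.
by rewrite -(SR x) Sx0 scaler0 linear0 subrr.
Qed.

Lemma rnorm_resolvent_opnorm (l : R[i]) x : l != 0 ->
  rnorm (resolvent T l x) <= opnorm (resolvent T l) * rnorm x.
Proof.
move=> l0; have [S [-> _ _ S_le]] := resolvent_spec l0.
exact: rnorm_opnorm (fun y => S_le y 1 ler01 (fun k n _ => tau_le1 n)).
Qed.

(** 0 is in the spectrum as the range of [T] is killed by [phi 0 0]. *)
Lemma shift_quasinilpotent : quasinilpotent T.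
Proof.
have e00 : phi 0%N 0%N (e 0%N 0%N) = 1 by rewrite (bio_dual bio).
apply/seteqP; split => [l /= nS|_ -> /= [S [_ _ SR]]].
  apply: contrapT => /eqP l0; apply: nS.
  have [S [_ SL SR S_le]] := resolvent_spec l0; exists S; split => //.
  apply/bounded_opP; eexists => x.
  exact: (S_le x 1 ler01 (fun k n _ => tau_le1 n)).
have := congr1 (phi 0%N 0%N) (SR (e 0%N 0%N)).
rewrite scale0r add0r linearN /= phi0T oppr0 e00 => /esym/eqP.
by rewrite oner_eq0.
Qed.

Lemma log_bound (a s t : R) : 0 < a -> 0 <= t -> t <= 1 -> 0 <= s ->
  ln (4 * expR s * expR (t * (s + 1) ^+ 2 / 4) * a) <=
  t * (s ^+ 2 / 4) + (4 + `|ln a|) * (s + 1).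
Proof.
move=> a0 t0 t1 s0.
rewrite lnM ?posrE ?mulr_gt0 ?expR_gt0//.
rewrite lnM ?posrE ?mulr_gt0 ?expR_gt0// lnM ?posrE ?expR_gt0// !expRK.
have ln4 : ln 4 <= 3 :> R.
  have -> : (4 : R) = 1 + 3 by ring.
  by apply: le_ln1Dx; lra.
have h1 := ler_norm (ln a); have h2 := mulr_ge0 (normr_ge0 (ln a)) s0.
have h3 : t * s <= s by rewrite ler_piMl.
by lra.
Qed.

Lemma growth_le_resolvent x t : x != 0 -> 0 <= t -> t <= 1 ->
  (forall k n, phi k n x != 0 -> tau n <= t) ->
  growth_le (fun l => rnorm (resolvent T l x)) t.
Proof.
move=> x0 t0 t1 xt.
apply: (growth_leW (A := 4 + `|ln (rnorm x)|) (s1 := 0)) => l l0 s0.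
have nx0 : 0 < rnorm x by rewrite rnorm_gt0.
have Rx0 := resolvent_neq0 l0 x0.
have := log_bound nx0 t0 t1 s0; rewrite sqrrN; apply: le_trans.
rewrite ler_ln ?posrE ?mulr_gt0 ?expR_gt0//.
by have [S [-> _ _ S_le]] := resolvent_spec l0; exact: S_le.
Qed.

Lemma growth_le_opnorm : growth_le (fun l => opnorm (resolvent T l)) 1.
Proof.
apply: (growth_leW (A := 4 + `|ln 1|) (s1 := 0)) => l l0 s0.
have := log_bound ltr01 ler01 (lexx 1) s0; rewrite sqrrN; apply: le_trans.
have e0 : e 0%N 0%N != 0.
  apply: contra_eq_neq (bio_dual bio 0 0 0 0) => ->.
  by rewrite linear0 eq_sym oner_neq0.
have op0 : 0 < opnorm (resolvent T l).
  have := lt_le_trans (resolvent_neq0 l0 e0) (rnorm_resolvent_opnorm _ l0).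
  by rewrite pmulr_lgt0// rnorm_gt0.
rewrite ler_ln ?posrE ?mulr_gt0 ?expR_gt0//.
have [S [-> _ _ S_le]] := resolvent_spec l0.
apply: opnorm_bound; first by rewrite !mulr_ge0 ?expR_ge0.
by move=> x; rewrite mulr1; exact: S_le.
Qed.

(** The coordinates of the orbit of [x] in the [n]-th summand satisfy the
    recursion of [orbit_growth], from the first nonzero coordinate on. *)
Lemma growth_ge_resolvent x k n : phi k n x != 0 ->
  growth_ge (fun l => rnorm (resolvent T l x)) (tau n).
Proof.
move=> xk; have exk : exists k, phi k n x != 0 by exists k.
pose k0 := ex_minn exk.
have [xk0 k0_min] : phi k0 n x != 0 /\ forall m, (m < k0)%N -> phi m n x = 0.
  rewrite /k0; case: ex_minnP => m xm m_min; split => // i im.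
  by apply/eqP; apply: contraTT im => /m_min; rewrite -leqNgt.
have x0 : x != 0 by apply: contra_neq xk => ->; rewrite linear0.
have C0 : 0 < C n := lt_le_trans ltr01 (bio_ge1 bio n).
have a0 : 0 < cabs (phi k0 n x) by rewrite cabs_gt0.
have [A [s1 orbit]] := orbit_growth k0 (tau_ge0 n) (tau_le1 n) (damp_gt0 bio n)
  (damp_le1 bio n) a0 (bio_bounded bio k0 n x).
apply: (growth_geW (A := A + `|ln (C n)|) (s1 := Num.max 0 s1)) => l l0.
rewrite ge_max => /andP[s0 /orbit]; set s := - ln (cabs l) in s0 *.
have lE : expR s = (cabs l)^-1 by rewrite /s expRN lnK// posrE cabs_gt0.
have [S [SE _ SR _]] := resolvent_spec l0; rewrite SE; pose y := S x.
have y_step m : l * (phi m.+1 n y : R[i]) = (phi m.+1 n x : R[i]) +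
    (damp C n * decay (tau n) ^+ (2 * m).+1)%:C * (phi m n y : R[i]).
  have := congr1 (phi m.+1 n) (SR x); rewrite linearB linearZ /= phiST -/y => <-.
  by rewrite subrK.
have y_0 : l * (phi 0%N n y : R[i]) = (phi 0%N n x : R[i]).
  by have := congr1 (phi 0%N n) (SR x); rewrite linearB linearZ /= phi0T subr0.
have y_lt m : (m < k0)%N -> phi m n y = 0.
  elim: m => [k0_gt0|m IH mk0]; apply/(mulfI l0); rewrite mulr0.
    by rewrite y_0 k0_min.
  by rewrite y_step k0_min// IH ?mulr0 ?addr0// ltnW.
move=> /(_ (fun m => cabs (phi m n y)))[||m Ym].
- have -> : phi k0 n x = l * (phi k0 n y : R[i]).
    case: (k0) y_lt => [//|i y_lt]; rewrite ?y_0//.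
    by rewrite y_step y_lt// mulr0 addr0.
  by rewrite Normc.normcM lE mulrA mulVf ?mul1r// gt_eqF// cabs_gt0.
- move=> m _; rewrite lE mulrC ler_pdivrMr ?cabs_gt0// [leRHS]mulrC -Normc.normcM.
  have w0 : 0 <= damp C n * decay (tau n) ^+ (2 * m).+1.
    by rewrite mulr_ge0 ?exprn_ge0 ?decay_ge0// ltW// (damp_gt0 bio).
  rewrite y_step -{1}(ger0_norm w0) -cabs_real -Normc.normcM.
  rewrite lerBlDr; apply: le_trans (lerD (lexx _) (bio_bounded bio m.+1 n x)).
  set z := _%:C * _; rewrite -[in leRHS](normcN (phi m.+1 n x)).
  apply: le_trans (le_normcD _ _).
  by rewrite addrAC subrr add0r.
have y0 : 0 < rnorm (S x) by rewrite -SE resolvent_neq0.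
have := le_trans Ym (bio_bounded bio m n y).
rewrite -[leRHS]lnK ?posrE ?mulr_gt0// ler_expR lnM ?posrE//.
have := ler_norm (ln (C n)); have := mulr_ge0 (normr_ge0 (ln (C n))) s0.
rewrite -/y sqrrN; have := normr_ge0 (ln (C n)); lra.
Qed.

(** The parameter 1 is attained in the summand 0, so [e 0 0] already forces the
    maximal growth. *)
Lemma growth_ge_opnorm : growth_ge (fun l => opnorm (resolvent T l)) 1.
Proof.
have e00 : phi 0%N 0%N (e 0%N 0%N) != 0.
  by rewrite (bio_dual bio) oner_neq0.
have e0 : e 0%N 0%N != 0 by apply: contra_neq e00 => ->; rewrite linear0.
move=> eta /(growth_ge_resolvent e00)[s0 s0P]; exists s0 => l l0 /(s0P _ l0).
rewrite tau0 => /le_trans; apply.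
have Re0 := resolvent_neq0 l0 e0.
have Re_le : rnorm (resolvent T l (e 0%N 0%N)) <= opnorm (resolvent T l).
  have := rnorm_resolvent_opnorm (e 0%N 0%N) l0.
  have op0 := lt_le_trans Re0 (rnorm_resolvent_opnorm _ l0).
  rewrite pmulr_lgt0 ?rnorm_gt0// in op0.
  by move=> /le_trans; apply; rewrite ler_piMr ?(ltW op0)// (bio_norm bio).
by rewrite ler_ln ?posrE// (lt_le_trans Re0).
Qed.

Definition index_support x : set R :=
  [set tau n | n in [set n | exists k, phi k n x != 0]].

Lemma index_support_nonempty x : x != 0 -> index_support x !=set0.
Proof.
move=> x0; apply: contrapT => nx; move/eqP: x0; apply.
apply: (bio_total bio) => k n; apply: contrapT => /eqP xkn; apply: nx.
by exists (tau n), n => //; exists k.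
Qed.

(** The upper bound is the resolvent bound for vectors meeting only summands of
    parameter at most the supremum; the lower bounds come from the single
    summands, whose parameters approach the supremum. *)
Lemma power_index_sup x : x != 0 -> power_index T x = (sup (index_support x))%:E.
Proof.
move=> x0; have x_nonempty := index_support_nonempty x0.
have x_sup : has_sup (index_support x).
  by split => //; exists 1 => _ [n _ <-].
have le_sup k n : phi k n x != 0 -> tau n <= sup (index_support x).
  by move=> xkn; apply: (ub_le_sup x_sup.2); exists n => //; exists k.
have [_ [n [k xkn] _]] := x_nonempty.
have t0 : 0 <= sup (index_support x) by rewrite (le_trans _ (le_sup _ _ xkn)).
have t1 : sup (index_support x) <= 1 by apply: ge_sup => // _ [m _ <-].
apply: limf_esup_ratio => //.
- exact: growth_le_resolvent le_sup.
- move=> eta eta0; have eta20 : 0 < eta / 2 by rewrite divr_gt0.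
  have [_ [m [i xim] <-] mP] := sup_adherent eta20 x_sup.
  have [s0 s0P] := growth_ge_resolvent xim eta20.
  exists s0 => l l0 /(s0P l l0); apply: le_trans.
  by rewrite ler_wpM2r ?divr_ge0 ?sqr_ge0//; lra.
- exact: growth_le_opnorm.
- exact: growth_ge_opnorm.
Qed.

(** A convergent combination of the first basis vectors of the summands. *)
Lemma vector_with_support (I : set nat) : exists x,
  forall k n, phi k n x != 0 <-> (k = 0%N /\ I n).
Proof.
pose v n : X := if `[< I n >] then (2 ^- n)%:C *: e 0%N n else 0.
have [|x vx] := @geometric_series_cvg _ _ v 1.
  move=> n; rewrite /v mul1r; case: ifP => _; last by rewrite rnorm0 invr_ge0 exprn_ge0.
  rewrite rnormZ cabs_real ger0_norm ?invr_ge0 ?exprn_ge0//.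
  by rewrite ler_piMr ?invr_ge0 ?exprn_ge0// (bio_norm bio).
exists x => k n.
have phiv m : phi k n (v m) = if `[< I m >] && (k == 0%N) && (n == m)
    then (2 ^- m)%:C : R[i] else 0.
  rewrite /v; case: ifP => _; last by rewrite linear0.
  rewrite linearZ /= (bio_dual bio); case: (k == 0%N) (n == m) => [] [] /=;
    by rewrite ?[_ *: _]mulr1 ?scaler0.
rewrite (bounded_linear_series_fin (Y := R[i]^o) (N := n.+1) (bio_bounded bio k n) vx);
    last first.
  by move=> m nm; rewrite phiv (ltn_eqF nm) andbF.
rewrite big_nat_recr//= big_nat_cond big1 ?add0r; last first.
  by move=> i /andP[/andP[_ i_n] _]; rewrite phiv (gtn_eqF i_n) andbF.
rewrite phiv eqxx andbT; have two0 : ((2 ^- n)%:C : R[i]) != 0.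
  by rewrite eq_complex /= eqxx andbT invr_eq0 expf_neq0.
case: asboolP => [In|nIn] /=; last by rewrite eqxx; split => [//|[_ /nIn]].
case: (k =P 0%N) => [k0|nk0] /=; first by split => // _; exact: two0.
by rewrite eqxx; split => [//|[/nk0]].
Qed.

Lemma power_set_shift (s : set R) : (forall n, s (tau n)) -> right_closed s ->
  (forall t eps, s t -> 0 < eps -> exists n, t - eps < tau n <= t) ->
  power_set T = EFin @` s.
Proof.
move=> s_tau s_closed tau_dense; apply/seteqP; split => [_ [x /= x0 <-]|_ [t st <-]].
  exists (sup (index_support x)); last by rewrite power_index_sup.
  apply: s_closed; last exact: index_support_nonempty.
  by move=> _ [n _ <-].
have [x xP] := vector_with_support [set n | tau n <= t].
have xE : index_support x = [set tau n | n in [set n | tau n <= t]].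
  apply/seteqP; split => _ [n nP <-]; exists n => //.
    by have [k /xP[]] := nP.
  by exists 0%N; apply/xP.
have [n /andP[_ nt]] := tau_dense t 1 st ltr01.
have x0 : x != 0.
  have : phi 0%N n x != 0 by apply/xP.
  by apply: contra_neq => ->; rewrite linear0.
exists x => //; rewrite power_index_sup// xE; congr EFin.
apply/eqP; rewrite eq_le; apply/andP; split.
  by apply: ge_sup; [exists (tau n), n | move=> _ [m mt <-]].
apply/ler_addgt0Pr => eps eps0; have [m /andP[tm mt]] := tau_dense t eps st eps0.
rewrite -lerBlDr (le_trans (ltW tm))//; apply: ub_le_sup.
  by exists t => _ [i it <-].
by exists m.
Qed.

End PowerSet.

Theorem theorem1p6 (R : realType) (X : completeNormedModType R[i])
    (u : nat -> nat -> {linear X -> X}) (sigma : set R) :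
  separable X ->
  infinite_dimensional [set: X] ->
  uniform_multiplicity_infinity X ->
  matrix_units u ->
  infinite_dimensional (range (u 0%N 0%N)) ->
  (exists b : nat -> X, unconditional_basis (range (u 0%N 0%N)) b) ->
  sigma `<=` `[0, 1] ->
  right_closed sigma ->
  sigma 1 ->
  exists T : {linear X -> X},
    [/\ bounded_op T, quasinilpotent T & power_set T = EFin @` sigma].
Proof.
move=> _ _ _ u_units _ [b [b_basis _]] sigma01 sigma_closed sigma1.
have [e [phi [C bio]]] := biorthogonal_exists u_units b_basis.
have [tau [tau0 s_tau tau_dense]] := left_dense_sequence sigma1.
have tau01 n : 0 <= tau n /\ tau n <= 1.
  by have := sigma01 _ (s_tau n); rewrite /= in_itv /= => /andP[].
have tau_ge0 n := (tau01 n).1; have tau_le1 n := (tau01 n).2.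
have [T [phi0T phiST T_iter]] := shift_operator_exists bio
  (fun n => decay_ge0 (tau n)) (fun n => decay_le_half (tau_ge0 n) (tau_le1 n)).
exists T; split.
- by apply/bounded_opP; exists 1 => x; apply: (shift_bounded (phi := phi) (tau := tau)).
- by apply: (shift_quasinilpotent bio (tau := tau)).
- by apply: (power_set_shift bio (tau := tau)).
Qed.
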